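(* In the setting described in the context, for every $p\in\{0,\dots,n\}$, $$L_p^N\xrightarrow[N\to\infty]{\text{a.s.}}L_p .$$ Moreover, for every $p\in\{0,\dots,n\}$ and every $f\in L^2(\eta)$, $\eta_p^N(f)\to\eta_p(f)$ in probability as $N\to\infty$, and for every bounded measurable $f:\mathbb{R}^d\to\mathbb{R}$, $\eta_p^N(f)\to\eta_p(f)$ almost surely as $N\to\infty$.
   Context: Let $d\ge1$ and let $\eta$ be a probability measure on $\mathbb{R}^d$ having a density with respect to Lebesgue measure (also denoted $\eta(x)$). Let $S:\mathbb{R}^d\to\mathbb{R}$ be Lipschitz with $|DS|>0$ almost everywhere ($|DS|$ is the Euclidean norm of the gradient). For $X\sim\eta$, $Y=S(X)$ has density $f_Y(s)=\int_{\{S(x)=s\}}\eta(x)\,\frac{\mathcal{H}^{d-1}(dx)}{|DS(x)|}$ ($\mathcal H^{d-1}$ the Hausdorff measure on the level set) and cdf $F_Y$. Fix $L^\star\in\mathbb{R}$ with $P:=\mathbb{P}(Y\ge L^\star)>0$ and $\alpha\in(0,1)$; let $n=\lfloor \log P/\log\alpha\rfloor$ and $r=P\alpha^{-n}$, and assume $r\in(\alpha,1)$. Set $L_{-1}=-\infty$ and $L_p=F_Y^{-1}(1-\alpha^{p+1})$ for $0\le p\le n$ (so $L_{n-1}<L^\star<L_n$). Assume $f_Y$ is continuous and strictly positive at each $L_p$, $0\le p\le n$. For $L\in\mathbb{R}$ let $\mathcal A_L=\{x:S(x)\ge L\}$, $G_L=\mathbf 1_{\mathcal A_L}$, and $G_p=G_{L_p}$.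 Define $\eta_p(dx)=\alpha^{-p}G_{p-1}(x)\eta(x)\,dx$ (so $\eta_0=\eta$). For each $p\ge1$, $K_p$ is a Markov kernel on $\mathbb{R}^d$ reversible with respect to $\eta$: $\eta(dx)K_p(x,dx')=\eta(dx')K_p(x',dx)$. For $L\in\mathbb{R}$, define $M_{p,L}(x,dx')=K_p(x,dx')\mathbf 1_{\mathcal A_L}(x')+K_p(x,\mathbb{R}^d\setminus\mathcal A_L)\delta_x(dx')$ if $x\in\mathcal A_L$, and $M_{p,L}(x,\cdot)=\delta_x$ if $x\notin\mathcal A_L$. Adaptive multilevel splitting with $N$ particles: every particle carries an independent Uniform$(0,1)$ mark $u$, and couples are totally ordered by $(x,u)<(x',u')$ iff $S(x)<S(x')$, or $S(x)=S(x')$ and $u<u'$. The empirical $(1-\alpha)$-quantile of a marked sample of size $N$ is the couple of rank $\lfloor N(1-\alpha)\rfloor$ in this order; exactly $\lceil N\alpha\rceil$ couples are strictly above it; when used as a real number it means its $S$-value. Start with $X_0^1,\dots,X_0^N$ i.i.d. with law $\eta$. For $p\ge0$: let $L_p^N$ be the empirical $(1-\alpha)$-quantile of the marked sample $(X_p^i)_i$; draw $X_{p+1/2}^1,\dots,X_{p+1/2}^N$ i.i.d. uniformly from the $\lceil N\alpha\rceil$ particles $X_p^i$ strictly above $L_p^N$; then, independently for each $i$, draw $X_{p+1}^i\sim M_{p+1,L_p^N}(X_{p+1/2}^i,\cdot)$ (with fresh marks). Let $\eta_p^N=\frac1N\sum_{i=1}^N\delta_{X_p^i}$. (The practical algorithm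 stops at the first $p$ with $L_p^N\ge L^\star$.) *)

(* Defs.v *)
From HB Require Import structures.
From mathcomp Require Import all_boot all_order all_algebra.
From mathcomp Require Import all_classical all_reals all_analysis.
Import numFieldNormedType.Exports.
Import Order.TTheory GRing.Theory Num.Theory.



Unset Printing Implicit Defensive.

Local Open Scope classical_set_scope.
Local Open Scope ring_scope.

(* R^d = 'rV[R]_d, equipped with the product (= Borel) sigma-algebra     *)
(* generated by the d coordinate projections.                            *)
Definition rV_display : measure_display. Proof. exact: default_measure_display. Qed.

Section rV_measurable.
Context {R : realType} (d : nat).
Let coor : 'I_d -> 'rV[R]_d -> R := fun i x => x ord0 i.
Let s0 : g_sigma_preimage coor set0. Proof. exact: sigma_algebra0. Qed.
Let sC A : g_sigma_preimage coor A -> g_sigma_preimage coor (~` A).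
Proof. by move=> h; rewrite -setTD; exact: sigma_algebraCD. Qed.
Let sU (F : _^nat) : (forall i, g_sigma_preimage coor (F i)) ->
  g_sigma_preimage coor (\bigcup_i (F i)).
Proof. by move=> h; apply: sigma_algebra_bigcup. Qed.
HB.instance Definition _ := @isMeasurable.Build rV_display 'rV[R]_d
  (g_sigma_preimage coor) s0 sC sU.
End rV_measurable.

Section defs.
Context {R : realType} {d : nat}.
Local Notation V := 'rV[R]_d.

Definition box (a b : V) : set V :=
  [set x | forall i : 'I_d, a ord0 i <= x ord0 i < b ord0 i].
Definition box_vol (a b : V) : R := \prod_(i < d) (b ord0 i - a ord0 i).
Definition leb_null (A : set V) : Prop :=
  forall e : R, 0 < e -> exists a b : nat -> V,
    (forall k (i : 'I_d), a k ord0 i <= b k ord0 i) /\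
    A `<=` \bigcup_k box (a k) (b k) /\
    (forall K : nat, \sum_(k < K) box_vol (a k) (b k) <= e).

(* eta has a density w.r.t. Lebesgue measure on R^d (absolute continuity) *)
Definition leb_abs_cont (mu : set V -> \bar R) : Prop :=
  forall A : set V, measurable A -> leb_null A -> mu A = 0%E.

Definition lipschitz (S : V -> R) : Prop :=
  exists C : R, forall x y : V, `|S x - S y| <= C * `|x - y|.

Definition grad_nonzero_ae (S : V -> R) : Prop :=
  leb_null [set x | ~ (differentiable S x /\ exists v : V, 'd S x v != 0)].

Definition cdfY (eta : set V -> \bar R) (S : V -> R) (t : R) : \bar R :=
  eta [set x | S x <= t].

Definition Lq (eta : set V -> \bar R) (S : V -> R) (alpha : R) (p : nat) : R :=
  inf [set t : R | ((1 - alpha ^+ p.+1)%:E <= cdfY eta S t)%E].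

(* eta_p(f) = alpha^{-p} int f G_{p-1} d eta, with L_{-1} = -oo *)
Definition eta_p (eta : {measure set V -> \bar R}) (S : V -> R) (alpha : R) (p : nat)
    (f : V -> R) : R :=
  alpha ^- p * fine (\int[eta]_(x in (if p is p'.+1 then
                         [set x | (Lq eta S alpha p' <= S x)%R] else setT))
                      (f x)%:E)%E.

Definition Mker (K : V -> set V -> \bar R) (S : V -> R) (L : R) (x : V)
    (B : set V) : \bar R :=
  if (L <= S x) then
    (K x (B `&` [set y | (L <= S y)%R]) + K x [set y | ~ (L <= S y)%R] * (\1_B x)%:E)%E
  else (\1_B x)%:E.

Definition lexle (a b : R * R) : bool := (a.1 < b.1) || ((a.1 == b.1) && (a.2 <= b.2)).
Definition lexlt (a b : R * R) : bool := (a.1 < b.1) || ((a.1 == b.1) && (a.2 < b.2)).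

(* rank floor(N(1-alpha)) (1-based) of the empirical (1-alpha)-quantile *)
Definition qrank (alpha : R) (N : nat) : nat := Num.truncn (N%:R * (1 - alpha)).

Definition emp_quantile (alpha : R) (N : nat) (c : 'I_N -> R * R) : R * R :=
  nth (0, 0) (sort lexle [seq c i | i <- enum 'I_N]) (qrank alpha N).-1.

Definition emp (N : nat) (x : 'I_N -> V) (f : V -> R) : R :=
  N%:R^-1 * \sum_(i < N) f (x i).

Section process.
Context {dO : measure_display} {Omega : measurableType dO}.
Variables (S : V -> R) (alpha : R)
  (X : forall N : nat, nat -> 'I_N -> Omega -> V)
  (U : forall N : nat, nat -> 'I_N -> Omega -> R)
  (Xh : forall N : nat, nat -> 'I_N -> Omega -> V).

Definition couples N p (w : Omega) (i : 'I_N) : R * R := (S (X N p i w), U N p i w).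
Definition LN N p (w : Omega) : R := (emp_quantile alpha N (couples N p w)).1.
Definition above N p (w : Omega) (j : 'I_N) : bool :=
  lexlt (emp_quantile alpha N (couples N p w)) (couples N p w j).

Definition hist_gen N (p k : nat) : set (set Omega) :=
  [set E | (exists q (i : 'I_N) (B : set V), (q <= p)%N /\ measurable B /\
                E = X N q i @^-1` B) \/
           (exists q (i : 'I_N) (C : set R), (q <= p)%N /\ measurable C /\
                E = U N q i @^-1` C) \/
           (exists q (i : 'I_N) (B : set V), (q < k)%N /\ measurable B /\
                E = Xh N q i @^-1` B)].
Definition Fhist N p : set (set Omega) := <<s hist_gen N p p >>.
Definition Fhalf N p : set (set Omega) := <<s hist_gen N p p.+1 >>.

(* The N-particle AMS algorithm (for every N for which the rank           *)
(* floor(N(1-alpha)) is >= 1), specified through its conditional laws.   *)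
Definition is_AMS (P : probability Omega R) (eta : probability V R)
    (K : nat -> R.-pker V ~> V) : Prop :=
  forall N : nat, (1 <= qrank alpha N)%N ->
  [/\
    (forall p i, measurable_fun setT (X N p i)) /\
    (forall p i, measurable_fun setT (U N p i)) /\
    (forall p i, measurable_fun setT (Xh N p i)),
    (* initialisation: (X_0^i, u_0^i) i.i.d. with law eta (x) Unif(0,1) *)
    (forall (B : 'I_N -> set V) (C : 'I_N -> set R),
       (forall i, measurable (B i)) -> (forall i, measurable (C i)) ->
       P (\bigcap_(i in [set: 'I_N]) (X N 0 i @^-1` B i `&` U N 0 i @^-1` C i))
       = (\prod_(i < N) (fine (eta (B i)) *
                         fine (lebesgue_measure (C i `&` `[0, 1]))))%:E),
    (* selection: given F_p, X_{p+1/2}^i i.i.d. uniform among the particles *)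
    (* X_p^j strictly above L_p^N                                           *)
    (forall p (E : set Omega) (B : 'I_N -> set V),
       Fhist N p E -> (forall i, measurable (B i)) ->
       P (E `&` \bigcap_(i in [set: 'I_N]) (Xh N p i @^-1` B i))
       = (\int[P]_(w in E)
            (\prod_(i < N) ((#|[pred j | above N p w j]|%:R)^-1 *
                 \sum_(j < N | above N p w j) \1_(B i) (X N p j w)))%:E)%E) &
    (* mutation: given F_{p+1/2}, X_{p+1}^i independent with law            *)
    (* M_{p+1, L_p^N}(X_{p+1/2}^i, .), with fresh i.i.d. Unif(0,1) marks     *)
    (forall p (E : set Omega) (B : 'I_N -> set V) (C : 'I_N -> set R),
       Fhalf N p E -> (forall i, measurable (B i)) -> (forall i, measurable (C i)) ->
       P (E `&` \bigcap_(i in [set: 'I_N])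
                 (X N p.+1 i @^-1` B i `&` U N p.+1 i @^-1` C i))
       = (\int[P]_(w in E)
            (\prod_(i < N)
               (fine (Mker (fun x B => K p.+1 x B) S (LN N p w) (Xh N p i w) (B i)) *
                fine (lebesgue_measure (C i `&` `[0, 1]))))%:E)%E)].
End process.
End defs.

(* Main.v *)
(* By induction on p, [eta_p^N(B)] concentrates around [eta_p(B)]
   exponentially fast in N, for every measurable set B.  No conditional
   expectation is needed: at each step one intersects with an event E of the past
   on which the average of the conditional success probabilities is bounded by a
   deterministic number, and applies a Chernoff bound on E.

   Since F_Y increases strictly and continuously at L_p, concentration of
   eta_p^N traps L_p^N in a small interval around L_p.  There the selection
   weights are close to the deterministic ones, because the shell
   [|S - L_p| <= e] has small mass; ties never matter.  The mutation kernel
   at level L_p^N differs from the one at level L_p by terms controlled by the mass of the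
   same shell, and the latter kernel leaves eta_{p+1} invariant by reversibility.

   For f in L^2(eta), on an event of probability tending to 1 the law of each
   particle is at most C eta, for some C not depending on N; this controls the
   tail part of f by C eta(f^2) / M. *)
Require Import Defs.
From HB Require Import structures.
From mathcomp Require Import all_boot all_order all_algebra.
From mathcomp Require Import all_classical all_reals all_analysis.
From mathcomp Require Import measurable_realfun ring lra.
Import numFieldNormedType.Exports.
Import Order.TTheory GRing.Theory Num.Theory.

Set Implicit Arguments.
Unset Strict Implicit.

Local Open Scope classical_set_scope.
Local Open Scope ring_scope.

(** * Summable families of events and a Chernoff bound *)

(** The obstacle is that the level [LN] is random and depends on all particles, so the selection
    weights and the mutation kernel are themselves random functions of the past. Each of them is
    replaced by an upper bound built from fixed sets: sublevel sets of [S], and one shell around the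
    limit level. Mutation is what forces functions into an induction about sets. Given the past, the
    chance that a moved particle falls in B is a function of its position before the move, not an
    indicator, so concentration must be extended to functions with values in [0,1] before the next
    step can be taken. The exponential rate serves Borel-Cantelli, which yields the two almost sure
    statements. For f in L^2 the tail part is controlled by Markov's inequality, whose bound does
    not decay with N at a fixed truncation level; this gives convergence in probability only. *)

Section monotone_integral.
Context {dO : measure_display} {T : measurableType dO} {R : realType}.
Variable mu : {measure set T -> \bar R}.

Import HBNNSimple.

(* Measurability of the integrands is not required: the weights of the algorithm
   (through [LN] and [above]) are never shown to be measurable. *)
Lemma ge0_le_integral_nomeas (D : set T) (f g : T -> \bar R) :
  (forall x, D x -> (0 <= f x)%E) -> (forall x, D x -> (f x <= g x)%E) ->
  (\int[mu]_(x in D) f x <= \int[mu]_(x in D) g x)%E.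
Proof.
move=> f0 fg.
have g0 x : D x -> (0 <= g x)%E by move=> Dx; exact: le_trans (f0 _ Dx) (fg _ Dx).
rewrite ge0_integralE// ge0_integralE//.
apply: ereal_sup_le => _ /= [h hf <-].
exists h => // x.
by apply: le_trans (hf x) _; exact: lee_restrict.
Qed.

End monotone_integral.

Section small_events.
Context {dO : measure_display} {T : measurableType dO} {R : realType}.
Variable Pr : probability T R.

(* The measurable cover [B] makes sense of this for events [D N] that are not
   known to be measurable. *)
Definition small (D : nat -> set T) : Prop :=
  exists B : nat -> set T, [/\ forall N, measurable (B N),
    \forall N \near \oo, D N `<=` B N & (\sum_(N <oo) Pr (B N) < +oo)%E].

Lemma small_sub (D D' : nat -> set T) :
  (\forall N \near \oo, D N `<=` D' N) -> small D' -> small D.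
Proof.
move=> DD' [B [mB D'B sB]]; exists B; split=> //.
by near=> N; apply: subset_trans (near D'B N _) => //; near: N.
Unshelve. all: by end_near. Qed.

Lemma small_setU (D D' : nat -> set T) :
  small D -> small D' -> small (fun N => D N `|` D' N).
Proof.
move=> [B [mB DB sB]] [B' [mB' DB' sB']]; exists (fun N => B N `|` B' N); split.
- by move=> N; exact: measurableU.
- by near=> N; apply: setUSS; near: N.
- apply: (@le_lt_trans _ _ (\sum_(N <oo) (Pr (B N) + Pr (B' N)))%E).
    by apply: lee_nneseries => // N _; exact: measureU2.
  by rewrite nneseriesD// lte_add_pinfty.
Unshelve. all: by end_near. Qed.

Lemma small_set0 : small (fun=> set0).
Proof.
exists (fun=> set0); split=> [N||]; [exact: measurable0|apply: nearW => N; exact: subset_refl|].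
by rewrite eseries0// => i _ _; rewrite measure0.
Qed.

Lemma small_bigcup (m : nat) (D : nat -> nat -> set T) :
  (forall k, (k < m)%N -> small (D k)) ->
  small (fun N => \bigcup_(k in `I_m) D k N).
Proof.
elim: m => [|m IH] sD.
  by apply: small_sub small_set0; apply: nearW => N x [].
apply: (@small_sub _ (fun N => \bigcup_(k in `I_m) D k N `|` D m N)).
  apply: nearW => N x [k /=]; rewrite ltnS leq_eqVlt => /predU1P[->|km] Dx.
    by right.
  by left; exists k.
by apply: small_setU; [apply: IH => k km; apply: sD; exact: ltnW|exact: sD].
Qed.

Lemma small_geometric (D : nat -> set T) (rho : R) : 0 <= rho < 1 ->
  (\forall N \near \oo, measurable (D N) /\ (Pr (D N) <= (rho ^+ N)%:E)%E) ->
  small D.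
Proof.
move=> /andP[rho0 rho1] [N0 _ DN].
(* [small] asks for measurable covers at every [N], while the hypothesis starts at [N0]; the earlier
   events are emptied. *)
exists (fun N => if (N0 <= N)%N then D N else set0); split.
- by move=> N; case: ifPn => // /DN[].
- by exists N0 => // N /= ->.
- apply: (@le_lt_trans _ _ (\sum_(N <oo) (rho ^+ N)%:E)%E).
    apply: lee_nneseries => // N _; case: ifPn => [/DN[]//|_].
    by rewrite measure0 lee_fin exprn_ge0.
  have /cvg_ex[l /= hl] : cvgn (series (geometric 1 rho)).
    by apply: is_cvg_geometric_series; rewrite ger0_norm.
  suff -> : (\sum_(N <oo) (rho ^+ N)%:E)%E = l%:E by rewrite ltry.
  apply/cvg_lim => //.
  rewrite [X in X @ _ --> _](_ : _ = EFin \o series (geometric 1 rho)); last first.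
    apply/funext => n /=; rewrite sumEFin; congr EFin.
    by apply: eq_bigr => i _; rewrite /geometric/= mul1r.
  by apply: cvg_comp hl _.
Qed.

(** Borel-Cantelli for the covers: their limsup is a measurable null set containing every outcome
    that lies in infinitely many [D N]. *)
Lemma small_ae (D : nat -> set T) : small D ->
  {ae Pr, forall w, \forall N \near \oo, ~ D N w}.
Proof.
move=> [B [mB DB sB]]; exists (lim_sup_set B); split.
- by apply: bigcapT_measurable => k; exact: bigcup_measurable.
- exact: lim_sup_set_cvg0.
- move=> w /= nw k _ /=; apply: contrapT => nB; apply: nw.
  case: DB => N0 _ DB; exists (maxn N0 k) => // N /=.
  rewrite geq_max => /andP[N0N kN] /(DB _ N0N) BNw.
  by apply: nB; exists N.
Qed.

(** Each term of the convergent series is at most the tail that it starts, and the tails tend to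
    0. *)
Lemma small_prob_le (D : nat -> set T) (e : R) : small D -> 0 < e ->
  (\forall N \near \oo, measurable (D N)) ->
  \forall N \near \oo, (Pr (D N) <= e%:E)%E.
Proof.
move=> [B [mB DB sB]] e0 mD.
have PB0 : Pr (B N) @[N --> \oo] --> 0%E.
  apply: (@squeeze_cvge _ _ _ _ (cst 0%E) _ (fun N => \sum_(N <= k <oo) Pr (B k))%E).
  - apply: nearW => N; rewrite measure_ge0/=.
    rewrite (@nneseries_split_cond _ _ N 1%N xpredT)// addn1 big_nat1.
    by rewrite leeDl// nneseries_ge0.
  - exact: cvg_cst.
  - by apply: nneseries_tail_cvg.
have /fine_cvgP[_ /cvgrPdist_le/(_ _ e0) PBe] := PB0.
near=> N; apply: (@le_trans _ _ (Pr (B N))).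
  by rewrite le_measure ?inE//; near: N.
rewrite -[Pr (B N)]fineK ?fin_num_measure// lee_fin.
have : `|0 - fine (Pr (B N))| <= e by near: N.
by rewrite sub0r normrN ger0_norm ?fine_ge0.
Unshelve. all: by end_near. Qed.

End small_events.

Section chernoff_bound.
Context {dO : measure_display} {T : measurableType dO} {R : realType}.
Variable Pr : probability T R.

(** From exp(th) <= 1 / (1 - th) follows t <= th / (1 - th), so it is enough that c1 < c2 (1 - th).
    The choice of [th] makes the right side the midpoint of c1 and c2. *)
Lemma chernoff_rate (c1 c2 : R) : 0 <= c1 < c2 ->
  exists t th : R, [/\ 0 < t, 0 < th, expR th = 1 + t & t * c1 < th * c2].
Proof.
move=> /andP[c10 c12]; have c20 : 0 < c2 by apply: le_lt_trans c12.
pose th := (c2 - c1) / (2 * c2).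
have th0 : 0 < th by rewrite divr_gt0 ?mulr_gt0 ?subr_gt0.
have th1 : 1 - th = (c1 + c2) / (2 * c2) by rewrite /th; field; rewrite gt_eqF.
have th1_gt0 : 0 < 1 - th by rewrite th1 divr_gt0 ?mulr_gt0 ?ltr_wpDl.
have eth : expR th <= (1 - th)^-1.
  rewrite -(invrK (expR th)) lef_pV2 ?posrE// ?invr_gt0 ?expR_gt0//.
  by rewrite -expRN expR_ge1Dx.
exists (expR th - 1), th; split=> //; first by rewrite subr_gt0 expR_gt1.
  by rewrite addrC subrK.
apply: (@le_lt_trans _ _ (((1 - th)^-1 - 1) * c1)).
  by rewrite ler_wpM2r// lerB.
have -> : (1 - th)^-1 - 1 = th * (1 - th)^-1 by field; rewrite gt_eqF.
rewrite -mulrA ltr_pM2l// mulrC ltr_pdivrMr// th1.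
have -> : c2 * ((c1 + c2) / (2 * c2)) = (c1 + c2) / 2 by field; rewrite gt_eqF.
lra.
Qed.

(* [1_{count >= N c2} <= exp (- th N c2) \prod_i (1 + t 1_{A_i})] with
   [exp th = 1 + t]; the product expands over the subsets [J] of indices, which is
   why only the joint probabilities of the [A_i] on [E] are needed. *)
Lemma chernoff (c1 c2 : R) : 0 <= c1 < c2 -> exists2 rho : R, 0 <= rho < 1 &
  forall (N : nat) (E : set T) (A : 'I_N -> set T) (q : 'I_N -> T -> R),
  measurable E -> (forall i, measurable (A i)) ->
  (forall i, measurable_fun setT (q i)) -> (forall i w, 0 <= q i w) ->
  (forall J : {set 'I_N},
    (Pr (E `&` \bigcap_(i in [set i | i \in J]) A i) <=
     \int[Pr]_(w in E) (\prod_(i in J) q i w)%:E)%E) ->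
  (forall w, E w -> \sum_(i < N) q i w <= N%:R * c1) ->
  (Pr (E `&` [set w | (N%:R * c2 <= \sum_(i < N) \1_(A i) w)%R]) <= (rho ^+ N)%:E)%E.
Proof.
move=> c12; have [t [th [t0 th0 eth tth]]] := chernoff_rate c12.
(* The factor exp(t c1) bounds the exponential moment per particle, and exp(- th c2) comes from
   Markov's inequality. *)
exists (expR (t * c1 - th * c2)).
  by rewrite expR_ge0 expR_lt1 subr_lt0.
move=> N E A q mE mA mq q0 HJ Hs.
set D := [set w | _].
have mZ : measurable_fun setT (fun w => \sum_(i < N) (\1_(A i) w : R)).
  by apply: measurable_sum => i; exact: measurable_indic.
have mD : measurable D.
  by rewrite -[D]setTI; apply: (measurable_fun_le _ _) => //; exact: measurable_cst.
pose Z w : R := \prod_(i < N) (1 + t * \1_(A i) w).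
have expand (u : 'I_N -> R) : \prod_(i < N) (1 + t * u i) =
    \sum_(J in {set 'I_N}) t ^+ #|J| * \prod_(i in J) u i.
  under eq_bigr do rewrite addrC.
  rewrite bigA_distr; apply: eq_bigr => J _.
  rewrite -prodr_const -big_split/= [RHS]big_mkcond/=.
  by apply: eq_bigr => i _.
have ZE w : Z w = expR (th * \sum_(i < N) \1_(A i) w).
  rewrite mulr_sumr expR_sum; apply: eq_bigr => i _.
  by rewrite indicE; case: (w \in A i); rewrite ?mulr1 ?mulr0 ?addr0 ?expR0 ?eth.
have key : (\int[Pr]_(w in E) (Z w)%:E <= (expR (N%:R * (t * c1)))%:E)%E.
  have intexp (u : 'I_N -> T -> R) : (forall i w, 0 <= u i w) ->
      (forall i, measurable_fun setT (u i)) ->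
      (\int[Pr]_(w in E) (\prod_(i < N) (1 + t * u i w))%:E =
       \sum_(J in {set 'I_N}) (t ^+ #|J|)%:E *
         \int[Pr]_(w in E) (\prod_(i in J) u i w)%:E)%E.
    move=> u0 mu.
    under eq_integral do rewrite expand -sumEFin.
    have mp (J : {set 'I_N}) : measurable_fun E (fun w => (\prod_(i in J) u i w)%:E).
      apply/measurable_EFinP; apply: (measurable_funS measurableT) => //.
      under eq_fun do rewrite big_mkcond/=.
      by apply: measurable_prod => i _; case: (i \in J) => //; exact: measurable_cst.
    rewrite ge0_integral_sum//.
    - apply: eq_bigr => J _; under eq_integral do rewrite EFinM.
      rewrite ge0_integralZl_EFin ?exprn_ge0 ?ltW// => w _.
      by rewrite lee_fin prodr_ge0.
    - move=> J; under eq_fun do rewrite EFinM.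
      by apply: emeasurable_funM => //; exact: measurable_cst.
    - by move=> J w _; rewrite lee_fin mulr_ge0 ?exprn_ge0 ?prodr_ge0 ?ltW.
  rewrite intexp; last 2 first.
    by move=> i w; rewrite indicE ler0n.
    by move=> i; exact: measurable_indic.
  (* The expansion is used in both directions: after [HJ] has been applied to each subset, the sum
     is folded back into a product, where 1 + x <= exp x brings in the sum bounded by [Hs]. *)
  apply: (@le_trans _ _ (\int[Pr]_(w in E) (\prod_(i < N) (1 + t * q i w))%:E)%E).
    rewrite intexp//; apply: lee_sum => J _.
    apply: lee_wpmul2l; first by rewrite lee_fin exprn_ge0// ltW.
    apply: le_trans (HJ J); rewrite setIC.
    have mJ : measurable (\bigcap_(i in [set i | i \in J]) A i).
      by apply: fin_bigcap_measurable => // i _; exact: mA.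
    rewrite -integral_indic//; apply: ge0_le_integral_nomeas => w _.
      by rewrite lee_fin prodr_ge0// => i _; rewrite indicE ler0n.
    rewrite lee_fin [leRHS]indicE.
    case: (pselect ((\bigcap_(i in [set i | i \in J]) A i) w)) => [h|h].
      rewrite (mem_set h) big1// => i iJ; rewrite indicE mem_set//.
      exact: h.
    rewrite (memNset h).
    have [i iJ nA] : exists2 i, i \in J & ~ A i w.
      apply: contrapT => hn; apply: h => i /= iJ; apply: contrapT => nA.
      by apply: hn; exists i.
    by rewrite (bigD1 i)//= indicE memNset// mul0r.
  apply: (@le_trans _ _ (\int[Pr]_(w in E) (cst (expR (N%:R * (t * c1)))%:E w))%E).
    apply: ge0_le_integral_nomeas => w Ew; rewrite lee_fin.
      by rewrite prodr_ge0// => i _; rewrite addr_ge0// mulr_ge0// ltW.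
    apply: (@le_trans _ _ (\prod_(i < N) expR (t * q i w))).
      apply: ler_prod => i _; rewrite expR_ge1Dx andbT.
      by rewrite addr_ge0// mulr_ge0// ltW.
    rewrite -expR_sum ler_expR -mulr_sumr mulrCA ler_pM2l//.
    exact: Hs.
  rewrite integral_cst// -[leRHS]mule1; apply: lee_wpmul2l.
    by rewrite lee_fin expR_ge0.
  exact: probability_le1.
have mED : measurable (E `&` D) by exact: measurableI.
have key2 : ((expR (N%:R * (th * c2)))%:E * Pr (E `&` D) <= (expR (N%:R * (t * c1)))%:E)%E.
  apply: le_trans key.
  rewrite -integral_cst//.
  apply: (@le_trans _ _ (\int[Pr]_(w in E `&` D) (Z w)%:E)%E).
    apply: ge0_le_integral_nomeas => w [Ew Dw].
      by rewrite lee_fin expR_ge0.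
    by rewrite /= lee_fin ZE ler_expR mulrCA ler_pM2l.
  apply: ge0_subset_integral => //; last 1 first.
  - by move=> w _; rewrite lee_fin ZE expR_ge0.
  - apply/measurable_EFinP; apply: (measurable_funS measurableT) => //.
    rewrite (_ : Z = fun w => expR (th * \sum_(i < N) \1_(A i) w)); last exact/funext.
    by apply: measurableT_comp => //; exact: measurable_funM.
have -> : expR (t * c1 - th * c2) ^+ N = expR (N%:R * (t * c1)) / expR (N%:R * (th * c2)).
  by rewrite -expRM_natl mulrBr expRD expRN.
have Pf : Pr (E `&` D) \is a fin_num by exact: fin_num_measure.
rewrite -(fineK Pf) in key2 *.
by move: key2; rewrite -EFinM !lee_fin ler_pdivlMr ?expR_gt0// mulrC.
Qed.

End chernoff_bound.

(** * Empirical means *)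

Section measurable_comparison.
Context {dO : measure_display} {T : measurableType dO} {R : realType}.
Implicit Types f g : T -> R.

Lemma measurable_le_set f g : measurable_fun setT f -> measurable_fun setT g ->
  measurable [set x | f x <= g x].
Proof. by move=> mf mg; rewrite -[X in measurable X]setTI; exact: measurable_fun_le. Qed.

Lemma measurable_lt_set f g : measurable_fun setT f -> measurable_fun setT g ->
  measurable [set x | f x < g x].
Proof.
move=> mf mg; rewrite (_ : [set x | _] = ~` [set x | g x <= f x]).
  by apply: measurableC; exact: measurable_le_set.
by apply/seteqP; split => x /=; rewrite ltNge => /negP.
Qed.

End measurable_comparison.

Section almost_sure.
Context {dO : measure_display} {T : measurableType dO} {R : realType}.
Variable Pr : probability T R.

(** The tolerances 1 / (k + 1) suffice, and there are countably many of them, so the exceptional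
    null sets can be united. *)
Lemma small_ae_cvg (Z : nat -> T -> R) (l : R) :
  (forall e, 0 < e -> small Pr (fun N => [set w | e <= `|Z N w - l|])) ->
  {ae Pr, forall w, (fun N => Z N w) @ \oo --> l}.
Proof.
move=> sZ.
have : {ae Pr, forall w, forall k : nat,
    \forall N \near \oo, ~ (k.+1%:R^-1 <= `|Z N w - l|)}.
  by apply: ae_foralln => k; apply: small_ae; apply: sZ; rewrite invr_gt0.
apply: filterS => w hw; apply/cvgrPdist_lt => e e0.
have [k _ ke] := near_infty_natSinv_lt (PosNum e0).
near=> N; apply: lt_le_trans (ltW (ke k (leqnn _))).
rewrite distrC ltNge; apply/negP.
by near: N; exact: hw.
Unshelve. all: by end_near. Qed.

End almost_sure.

Section empirical_mean.
Context {R : realType} {d : nat}.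
Local Notation V := 'rV[R]_d.
Implicit Types (N : nat) (f g : V -> R).

Lemma emp_le N (x : 'I_N -> V) f g : (forall y, f y <= g y) ->
  emp N x f <= emp N x g.
Proof.
by move=> fg; rewrite ler_wpM2l ?invr_ge0//; apply: ler_sum.
Qed.

Lemma emp_ge0 N (x : 'I_N -> V) f : (forall y, 0 <= f y) -> 0 <= emp N x f.
Proof. by move=> f0; rewrite mulr_ge0 ?invr_ge0// sumr_ge0. Qed.

Lemma empD N (x : 'I_N -> V) f g :
  emp N x (fun y => f y + g y) = emp N x f + emp N x g.
Proof. by rewrite /emp big_split mulrDr. Qed.

Lemma empZ N (x : 'I_N -> V) (c : R) f :
  emp N x (fun y => c * f y) = c * emp N x f.
Proof. by rewrite /emp -mulr_sumr mulrCA. Qed.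

Lemma emp_sum N (x : 'I_N -> V) (m : nat) (f : nat -> V -> R) :
  emp N x (fun y => \sum_(k < m) f k y) = \sum_(k < m) emp N x (f k).
Proof. by rewrite /emp exchange_big mulr_sumr. Qed.

Lemma emp_cst N (x : 'I_N -> V) (c : R) : (0 < N)%N -> emp N x (fun=> c) = c.
Proof.
move=> N0; rewrite /emp sumr_const card_ord -[c *+ N]mulr_natl mulrA mulVf ?mul1r//.
by rewrite pnatr_eq0 -lt0n.
Qed.

Lemma emp_indicC N (x : 'I_N -> V) (B : set V) : (0 < N)%N ->
  emp N x \1_(~` B) = 1 - emp N x \1_B.
Proof.
move=> N0; apply/eqP; rewrite eq_sym subr_eq -empD -(emp_cst x 1 N0).
apply/eqP; congr emp; apply/funext => y; rewrite !indicE in_setC.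
by case: (y \in B); rewrite ?addr0 ?add0r.
Qed.

End empirical_mean.

(** * Concentration: from sets to bounded functions *)

Section concentration.
Context {R : realType} {d : nat} {dO : measure_display} {T : measurableType dO}.
Local Notation V := 'rV[R]_d.
Variables (Pr : probability T R) (eta : probability V R).

(* [eta_p eta S alpha p f] is convertible to [wint (alpha ^- p) (lset p) f], with
   [lset] as defined below. *)
Definition wint (w : R) (A : set V) (f : V -> R) : R :=
  w * fine (\int[eta]_(x in A) (f x)%:E)%E.

(* Only the upper tail: the lower tail for [B] is the upper tail for [~` B]. *)
Definition conc (w : R) (A : set V) (Y : forall N, 'I_N -> T -> V) : Prop :=
  forall B, measurable B -> forall e, 0 < e ->
  small Pr (fun N => [set om | wint w A \1_B + e <= emp N (@Y N ^~ om) \1_B]).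

Variables (w : R) (A : set V).
Hypotheses (w0 : 0 <= w) (mA : measurable A).

Lemma bounded_integrable (f : V -> R) (M : R) : measurable_fun setT f ->
  (forall x, `|f x| <= M) -> eta.-integrable A (EFin \o f).
Proof.
move=> mf fM; apply: measurable_bounded_integrable => //.
- by rewrite (le_lt_trans (probability_le1 _ _))// ltry.
- exact: measurable_funS mf.
- exists M; split; first exact: num_real.
  by move=> y My x _; apply: le_trans (ltW My).
Qed.

Lemma indic_integrable (B : set V) : measurable B ->
  eta.-integrable A (EFin \o (\1_B : V -> R)).
Proof.
move=> mB; apply: (@bounded_integrable _ 1); first exact: measurable_indic.
by move=> x; rewrite ger0_norm indicE ?ler0n// lern1 leq_b1.
Qed.

Lemma wint_le (f g : V -> R) : eta.-integrable A (EFin \o f) ->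
  eta.-integrable A (EFin \o g) -> (forall x, A x -> f x <= g x) ->
  wint w A f <= wint w A g.
Proof. by move=> If Ig fg; rewrite ler_wpM2l//; exact: le_Rintegral. Qed.

Lemma integrableD_real (f g : V -> R) : eta.-integrable A (EFin \o f) ->
  eta.-integrable A (EFin \o g) -> eta.-integrable A (EFin \o (fun x => f x + g x)).
Proof. by move=> If Ig; exact: (integrableD mA If Ig). Qed.

Lemma wintD (f g : V -> R) : eta.-integrable A (EFin \o f) ->
  eta.-integrable A (EFin \o g) ->
  wint w A (fun x => f x + g x) = wint w A f + wint w A g.
Proof.
move=> If Ig; rewrite /wint -mulrDr; congr (_ * _).
exact: RintegralD.
Qed.

Lemma wintZ (c : R) (f : V -> R) : eta.-integrable A (EFin \o f) ->
  wint w A (fun x => c * f x) = c * wint w A f.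
Proof.
move=> If; rewrite /wint mulrCA; congr (_ * _).
exact: RintegralZl.
Qed.

Lemma wint_cst (c : R) : wint w A (fun=> c) = c * (w * fine (eta A)).
Proof.
rewrite /wint mulrCA; congr (_ * _).
exact: Rintegral_cst.
Qed.

Lemma wint_indic (B : set V) : measurable B ->
  wint w A \1_B = w * fine (eta (B `&` A)).
Proof. by move=> mB; rewrite /wint integral_indic. Qed.

Lemma wint_ge0 (f : V -> R) : (forall x, 0 <= f x) -> 0 <= wint w A f.
Proof. by move=> f0; rewrite mulr_ge0//; exact: Rintegral_ge0. Qed.

Lemma wint_sum (m : nat) (f : nat -> V -> R) :
  (forall k, eta.-integrable A (EFin \o f k)) ->
  eta.-integrable A (EFin \o (fun x => \sum_(k < m) f k x)) /\
  wint w A (fun x => \sum_(k < m) f k x) = \sum_(k < m) wint w A (f k).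
Proof.
move=> If; elim: m => [|m [Im IH]].
  rewrite big_ord0; under [X in wint _ _ X]eq_fun do rewrite big_ord0.
  rewrite wint_cst mul0r; split => //.
  rewrite (_ : _ \o _ = cst 0%E); first exact: integrable0.
  by apply/funext => x /=; rewrite big_ord0.
have E : (fun x => \sum_(k < m.+1) f k x) = (fun x => \sum_(k < m) f k x + f m x).
  by apply/funext => x; rewrite big_ord_recr.
rewrite E big_ord_recr/= -IH wintD//; split => //.
exact: integrableD_real.
Qed.

(** The sum counts the naturals strictly below [y], so it is the ceiling of [y]. *)
Lemma step_count (m : nat) (y : R) : 0 <= y <= m%:R ->
  y <= \sum_(k < m) ((k%:R < y)%R : nat)%:R <= y + 1.
Proof.
elim: m => [|m IH] /andP[y0 ym].
  by rewrite big_ord0 ym addr_ge0.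
rewrite big_ord_recr/=; have [my|ym'] := ltP m%:R y.
  rewrite (eq_bigr (fun=> 1)); last first.
    move=> i _; rewrite (_ : _ < _)//; apply: le_lt_trans my.
    by rewrite ler_nat ltnW.
  rewrite sumr_const card_ord -natr1 in ym *.
  by rewrite ym/= lerD2r ltW.
by rewrite addr0 IH// y0.
Qed.

Variable Y : forall N, 'I_N -> T -> V.
Hypothesis cY : conc w A Y.

(* From sets to functions: [f] lies within [1/m] below the step function
   [1/m \sum_(k < m) 1_{k < m f}]. *)
Lemma conc_unit (f : V -> R) (e : R) : measurable_fun setT f ->
  (forall x, 0 <= f x <= 1) -> 0 < e ->
  small Pr (fun N => [set om | wint w A f + e <= emp N (@Y N ^~ om) f]).
Proof.
move=> mf f01 e0.
pose C := w * fine (eta A).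
have C0 : 0 <= C by rewrite mulr_ge0// fine_ge0.
(* Rounding [f] up by at most 1/m costs C/m in the integral; this spends half of [e]. *)
have [m0 Cm] : exists m, C / (e / 2) < m%:R.
  by exists (Num.bound (C / (e / 2))); rewrite archi_boundP// divr_ge0// ltW// divr_gt0.
have m_gt0 : 0 < m0%:R :> R by apply: le_lt_trans Cm; rewrite divr_ge0// ltW// divr_gt0.
pose B k := [set x | k%:R < m0%:R * f x].
have mB k : measurable (B k).
  by apply: measurable_lt_set => //; exact: measurable_funM.
pose F x := m0%:R^-1 * \sum_(k < m0) (\1_(B k) x : R).
have FE x : \sum_(k < m0) (\1_(B k) x : R) = \sum_(k < m0) ((k%:R < m0%:R * f x)%R : nat)%:R.
  by apply: eq_bigr => k _; rewrite indicE /B mem_setE.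
have fF x : f x <= F x <= f x + m0%:R^-1.
  have := @step_count m0 (m0%:R * f x); rewrite -FE.
  have /andP[f0 f1] := f01 x.
  rewrite mulr_ge0//= ler_piMr// => /(_ isT)/andP[h1 h2].
  rewrite /F ler_pdivlMl// h1/= ler_pdivrMl// mulrDr mulfV ?gt_eqF//.
have If : eta.-integrable A (EFin \o f).
  by apply: (@bounded_integrable _ 1) => // x; have /andP[? ?] := f01 x; rewrite ger0_norm.
have I1 k : eta.-integrable A (EFin \o (\1_(B k) : V -> R)) by exact: indic_integrable.
have [IS SE] := @wint_sum m0 (fun k => \1_(B k)) I1.
have Icst (c : R) : eta.-integrable A (EFin \o (fun=> c)).
  by apply: (@bounded_integrable _ `|c|).
have IF : eta.-integrable A (EFin \o F).
  apply: (@bounded_integrable _ 2) => [|x].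
    apply: measurable_funM => //.
    by apply: measurable_sum => k; exact: measurable_indic.
  have /andP[h1 h2] := fF x; have /andP[f0 f1] := f01 x.
  rewrite ger0_norm ?(le_trans f0)// (le_trans h2)//.
  rewrite (_ : 2 = 1 + 1)// lerD// invf_le1// ler1n.
  by move: m_gt0; rewrite ltr0n.
have wF : wint w A F <= wint w A f + C / m0%:R.
  rewrite (_ : C / _ = wint w A (fun=> m0%:R^-1)); last by rewrite wint_cst mulrC.
  rewrite -wintD//; apply: wint_le => // [|x _]; last by have /andP[] := fF x.
  exact: integrableD_real.
have Ce : C / m0%:R < e / 2.
  by rewrite ltr_pdivrMr// mulrC -ltr_pdivrMr// divr_gt0.
(* The other half of [e] is allotted to every set [B k]: the [m0] deviations are averaged with
   weight 1/m0, so they do not add up. *)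
apply: (@small_sub _ _ _ _ _ (fun N => \bigcup_(k in `I_m0)
   [set om | wint w A \1_(B k) + e / 2 <= emp N (@Y N ^~ om) \1_(B k)])).
  apply: nearW => N om /= hom; apply: contrapT => hn.
  have hk (k : 'I_m0) : emp N (@Y N ^~ om) \1_(B k) <= wint w A \1_(B k) + e / 2.
    rewrite leNgt; apply/negP => hlt; apply: hn; exists k => //=; exact: ltW.
  have : emp N (@Y N ^~ om) f <= wint w A F + e / 2.
    apply: (@le_trans _ _ (emp N (@Y N ^~ om) F)).
      by apply: emp_le => x; have /andP[] := fF x.
    rewrite /F empZ (emp_sum _ _ (fun k => \1_(B k))) wintZ// SE ler_pdivrMl//.
    rewrite mulrDr mulrA mulfV ?gt_eqF// mul1r.
    rewrite (_ : m0%:R * _ = \sum_(k < m0) (e / 2)); last first.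
      by rewrite sumr_const card_ord mulr_natl.
    by rewrite -big_split; apply: ler_sum => k _; exact: hk.
  by move: hom wF Ce; lra.
by apply: small_bigcup => k _; apply: cY => //; rewrite divr_gt0.
Qed.

Hypothesis mass1 : w * fine (eta A) = 1.

(** An affine change of [f] reduces to values in [0,1]. It adds a constant, whose weighted integral
    equals its empirical mean because the total mass is 1. *)
Lemma conc_bounded_le (f : V -> R) (M e : R) : measurable_fun setT f ->
  (forall x, `|f x| <= M) -> 0 < e ->
  small Pr (fun N => [set om | wint w A f + e <= emp N (@Y N ^~ om) f]).
Proof.
move=> mf fM e0; pose K := M + 1.
have K0 : 0 < K by rewrite /K ltr_wpDl// (le_trans _ (fM 0)).
have K20 : 0 < 2 * K by rewrite mulr_gt0.
have If : eta.-integrable A (EFin \o f) by exact: bounded_integrable fM.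
have Icst (c : R) : eta.-integrable A (EFin \o (fun=> c)).
  by apply: (@bounded_integrable _ `|c|).
pose g x := (2 * K)^-1 * (f x + K).
have ig : wint w A g = (2 * K)^-1 * (wint w A f + K).
  rewrite wintZ ?wintD// ?wint_cst ?mass1 ?mulr1//.
  exact: integrableD_real.
have := @conc_unit g (e / (2 * K)).
move=> h; apply: small_sub (h _ _ _) => {h}.
- exists 1%N => // N /= N0 om /= h.
  rewrite ig /g empZ empD emp_cst// [e / _]mulrC -mulrDr ler_pM2l ?invr_gt0//.
  by move: h; lra.
- apply: measurable_funM; first exact: measurable_cst.
  by apply: measurable_funD => //; exact: measurable_cst.
- move=> x; have := fM x; rewrite ler_norml => /andP[h1 h2].
  rewrite /g mulr_ge0/= ?invr_ge0 ?(ltW K20)//; last by rewrite /K; lra.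
  by rewrite ler_pdivrMl// mulr1 /K; lra.
- by rewrite divr_gt0.
Qed.

Lemma conc_bounded (f : V -> R) (M e : R) : measurable_fun setT f ->
  (forall x, `|f x| <= M) -> 0 < e ->
  small Pr (fun N => [set om | e <= `|emp N (@Y N ^~ om) f - wint w A f|]).
Proof.
move=> mf fM e0.
have If : eta.-integrable A (EFin \o f) by exact: bounded_integrable fM.
have h1 := conc_bounded_le mf fM e0.
have h2 : small Pr (fun N => [set om | wint w A (fun x => -1 * f x) + e <=
    emp N (@Y N ^~ om) (fun x => -1 * f x)]).
  apply: (@conc_bounded_le _ M) => // [|x]; last by rewrite mulN1r normrN.
  by apply: measurable_funM => //; exact: measurable_cst.
apply: small_sub (small_setU h1 h2); apply: nearW => N om /=.
rewrite empZ wintZ// !mulN1r ler_normr => /orP[h|h]; [left|right]; lra.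
Qed.

End concentration.

(** * Empirical quantile and selection weights *)

Section empirical_quantile.
Context {R : realType}.
Implicit Types (alpha t : R) (N : nat).

Lemma lexle_total : total (@lexle R).
Proof.
move=> [a b] [c e]; rewrite /lexle/=.
by case: (ltgtP a c) => //= _; exact: le_total.
Qed.

Lemma qrank_le alpha N : 0 < alpha < 1 -> (qrank alpha N <= N)%N.
Proof.
move=> /andP[a0 a1]; rewrite /qrank -(ler_nat R).
have h : 0 <= N%:R * (1 - alpha) by rewrite mulr_ge0// subr_ge0 ltW.
apply: (@le_trans _ _ (N%:R * (1 - alpha))); first by rewrite truncn_le.
by rewrite ler_piMr// gerBl ltW.
Qed.

Variables (alpha t : R) (N : nat) (c : 'I_N -> R * R).
Hypothesis alpha01 : 0 < alpha < 1.
Hypothesis qrank_gt0 : (1 <= qrank alpha N)%N.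

(** Projecting the lexicographic sort to first coordinates leaves a sorted list, so the [S]-value of
    the quantile is an ordinary order statistic and the marks disappear. Ranks start at 1 and list
    positions at 0, hence the predecessor below. *)
Let s := map fst (sort (@lexle R) [seq c i | i <- enum 'I_N]).

Let sorted_s : sorted <=%R s.
Proof.
rewrite sorted_map; apply: sub_sorted (sort_sorted lexle_total _).
by move=> [a b] [a' b'] /orP[/= /ltW//|/= /andP[/eqP->]].
Qed.

Let size_s : size s = N.
Proof. by rewrite size_map size_sort size_map size_enum_ord. Qed.

Let rank_lt : ((qrank alpha N).-1 < N)%N.
Proof. by rewrite prednK// qrank_le. Qed.

Let quantileE : (emp_quantile alpha N c).1 = nth 0 s (qrank alpha N).-1.
Proof.
rewrite /s (nth_map (0, 0))// size_sort size_map size_enum_ord.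
exact: rank_lt.
Qed.

Let count_s : (count (<= t) s)%:R = \sum_(i < N) ((c i).1 <= t)%R%:R :> R.
Proof.
rewrite -natr_sum; congr (_%:R).
have /permP -> : perm_eq s (map fst [seq c i | i <- enum 'I_N]).
  by apply: perm_map; rewrite perm_sort.
rewrite -map_comp count_map -sum1_count big_enum_cond/= big_mkcond/=.
by apply: eq_bigr => i _; case: ifP.
Qed.

Lemma emp_quantile_le :
  (qrank alpha N)%:R <= \sum_(i < N) ((c i).1 <= t)%R%:R :> R ->
  (emp_quantile alpha N c).1 <= t.
Proof.
rewrite -count_s ler_nat => h; rewrite quantileE.
by apply: nth_count_le => //; rewrite prednK.
Qed.

Lemma emp_quantile_gt :
  \sum_(i < N) ((c i).1 <= t)%R%:R < (qrank alpha N)%:R :> R ->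
  t < (emp_quantile alpha N c).1.
Proof.
rewrite -count_s ltr_nat => h; rewrite quantileE.
apply: nth_count_gt => //; rewrite size_s rank_lt andbT.
by rewrite -ltnS prednK.
Qed.

End empirical_quantile.

Section selection_weights.
Context {R : realType} {d : nat} {dO : measure_display} {T : measurableType dO}.
Local Notation V := 'rV[R]_d.
Variables (S : V -> R) (alpha : R).
Variables (X : forall N : nat, nat -> 'I_N -> T -> V).
Variables (U : forall N : nat, nat -> 'I_N -> T -> R).
Hypothesis alpha01 : 0 < alpha < 1.
Implicit Types (N p : nat) (w : T).

Let sum_indicE N p w (B : set V) : (0 < N)%N ->
  \sum_(i < N) (\1_B (X p i w) : R) = N%:R * emp N (X p ^~ w) \1_B.
Proof. by move=> N0; rewrite /emp mulrA mulfV ?mul1r// pnatr_eq0 -lt0n. Qed.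

Let rank_pos N : (1 <= qrank alpha N)%N -> (0 < N)%N.
Proof. by move=> h; apply: leq_trans h _; exact: qrank_le. Qed.

Let below_sumE N p w t : (0 < N)%N ->
  \sum_(i < N) ((couples S X U N p w i).1 <= t)%R%:R =
  N%:R * emp N (X p ^~ w) \1_[set x | S x <= t].
Proof.
move=> N0; rewrite -sum_indicE//; apply: eq_bigr => i _.
by rewrite indicE mem_setE.
Qed.

Lemma LN_le N p w t : (1 <= qrank alpha N)%N ->
  (qrank alpha N)%:R <= N%:R * emp N (X p ^~ w) \1_[set x | S x <= t] ->
  LN S alpha X U N p w <= t.
Proof.
move=> q1 h; apply: emp_quantile_le => //.
by rewrite below_sumE// rank_pos.
Qed.

Lemma LN_gt N p w t : (1 <= qrank alpha N)%N ->
  N%:R * emp N (X p ^~ w) \1_[set x | S x <= t] < (qrank alpha N)%:R ->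
  t < LN S alpha X U N p w.
Proof.
move=> q1 h; apply: emp_quantile_gt => //.
by rewrite below_sumE// rank_pos.
Qed.

(** A particle can be above the quantile by its mark alone, at equal [S]-value; hence a weak
    inequality here and a strict one in the converse [LN_lt_above]. *)
Lemma above_LN_le N p w j : above S alpha X U N p w j ->
  LN S alpha X U N p w <= S (X p j w).
Proof. by move=> /orP[/ltW//|/andP[/eqP h _]]; rewrite /LN h. Qed.

Lemma LN_lt_above N p w j : LN S alpha X U N p w < S (X p j w) ->
  above S alpha X U N p w j.
Proof. by rewrite /above /lexlt /LN => ->. Qed.

Lemma card_above_ge N p w b : (0 < N)%N -> LN S alpha X U N p w <= b ->
  N%:R * emp N (X p ^~ w) \1_[set x | b < S x] <=
  #|[pred j | above S alpha X U N p w j]|%:R.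
Proof.
move=> N0 Lb; rewrite -sum_indicE// -sum1_card natr_sum [leRHS]big_mkcond/=.
apply: ler_sum => i _; rewrite indicE inE.
have [bS|bS] := ltP b (S (X p i w)).
  by rewrite LN_lt_above ?(le_lt_trans Lb)// lern1 leq_b1.
by rewrite memNset ?ler0n//=; [case: ifP|rewrite ltNge bS].
Qed.

Lemma sum_above_le N p w a (B : set V) : (0 < N)%N -> a < LN S alpha X U N p w ->
  \sum_(j < N | above S alpha X U N p w j) (\1_B (X p j w) : R) <=
  N%:R * emp N (X p ^~ w) \1_(B `&` [set x | a < S x]).
Proof.
move=> N0 aL; rewrite -sum_indicE// big_mkcond/=.
apply: ler_sum => i _; rewrite !indicE in_setI.
case: ifPn => [h|_]; last by rewrite ler0n.
by rewrite [_ \in [set x | _]]mem_set ?andbT//=; exact: lt_le_trans (above_LN_le h).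
Qed.

(** The lower end of the interval enlarges the numerator and the upper end shrinks the denominator,
    so the random level gives way to empirical masses of fixed sets. *)
Lemma selection_weight_le N p w a b (B : set V) : (0 < N)%N ->
  a < LN S alpha X U N p w <= b -> 0 < emp N (X p ^~ w) \1_[set x | b < S x] ->
  #|[pred j | above S alpha X U N p w j]|%:R^-1 *
    \sum_(j < N | above S alpha X U N p w j) (\1_B (X p j w) : R) <=
  emp N (X p ^~ w) \1_(B `&` [set x | a < S x]) /
    emp N (X p ^~ w) \1_[set x | b < S x].
Proof.
move=> N0 /andP[aL Lb] e0.
have NR0 : 0 < N%:R :> R by rewrite ltr0n.
have h1 := card_above_ge N0 Lb; have h2 := sum_above_le B N0 aL.
have ca : 0 < N%:R * emp N (X p ^~ w) \1_[set x | b < S x] by rewrite mulr_gt0.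
set E1 := emp N _ \1_(B `&` _); set E2 := emp N _ _ in e0 ca h1 *.
have -> : E1 / E2 = (N%:R * E2)^-1 * (N%:R * E1).
  by field; rewrite gt_eqF//= gt_eqF.
apply: ler_pM => //; first by rewrite sumr_ge0// => j _; rewrite indicE ler0n.
by rewrite lef_pV2 ?posrE// (lt_le_trans ca).
Qed.

End selection_weights.

(** * The levels L_p *)

Section level_facts.
Context {R : realType} {d : nat}.
Local Notation V := 'rV[R]_d.
Variables (eta : probability V R) (S : V -> R) (alpha : R).
Hypotheses (mS : measurable_fun setT S) (alpha01 : 0 < alpha < 1).

Definition pr (B : set V) : R := fine (eta B).

Lemma prE (B : set V) : measurable B -> eta B = (pr B)%:E.
Proof. by move=> mB; rewrite fineK// fin_num_measure. Qed.

Lemma pr_ge0 (B : set V) : 0 <= pr B.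
Proof. by rewrite fine_ge0. Qed.

Lemma pr_le (B C : set V) : measurable B -> measurable C -> B `<=` C ->
  pr B <= pr C.
Proof. by move=> mB mC BC; rewrite -lee_fin -!prE// le_measure// inE. Qed.

Lemma prT : pr setT = 1.
Proof. by rewrite /pr probability_setT. Qed.

Lemma pr0 : pr set0 = 0.
Proof. by rewrite /pr measure0. Qed.

Lemma prU (B C : set V) : measurable B -> measurable C ->
  pr (B `|` C) <= pr B + pr C.
Proof.
by move=> mB mC; rewrite -lee_fin EFinD -!prE//; [exact: measureU2|exact: measurableU].
Qed.

Lemma pr_split (B C : set V) : measurable B -> measurable C ->
  pr B = pr (B `&` C) + pr (B `&` ~` C).
Proof.
move=> mB mC; have mI := measurableI _ _ mB mC.
have mI' := measurableI _ _ mB (measurableC mC).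
apply: EFin_inj; rewrite EFinD -!prE// -measureU//.
  by rewrite -setIUr setUv setIT.
by rewrite setIACA setICr setI0.
Qed.

Lemma prC (B : set V) : measurable B -> pr (~` B) = 1 - pr B.
Proof.
move=> mB; have := pr_split measurableT mB; rewrite !setTI prT => ->.
by rewrite addrC addKr.
Qed.

Lemma measurable_Sle t : measurable [set x | S x <= t].
Proof. by apply: measurable_le_set. Qed.
Lemma measurable_Sge t : measurable [set x | t <= S x].
Proof. by apply: measurable_le_set. Qed.
Lemma measurable_Sgt t : measurable [set x | t < S x].
Proof. by apply: measurable_lt_set. Qed.
Lemma measurable_Snear l e : measurable [set x | `|S x - l| <= e].
Proof.
apply: measurable_le_set => //; apply: measurableT_comp => //.
exact: measurable_funB.
Qed.

Local Notation F t := (pr [set x | S x <= t]).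

Lemma cdf_le a b : a <= b -> F a <= F b.
Proof.
move=> ab; apply: pr_le; [exact: measurable_Sle..|].
by move=> x /= /le_trans; exact.
Qed.

Lemma pr_gt t : pr [set x | t < S x] = 1 - F t.
Proof.
rewrite -prC; last exact: measurable_Sle.
by congr pr; apply/seteqP; split => x /=; rewrite ltNge => /negP.
Qed.

(** With [cdf_leaves], this makes the set that defines [Lq] nonempty and bounded below, so that [Lq]
    is a genuine infimum. *)
Lemma cdf_reaches (v : R) : v < 1 -> exists t, v < F t.
Proof.
move=> v1.
have mk (k : nat) : measurable [set x | S x <= k%:R] by exact: measurable_Sle.
have : eta [set x | S x <= k%:R] @[k --> \oo] --> eta (\bigcup_k [set x | S x <= k%:R]).
  apply: nondecreasing_cvg_mu => //; first exact: bigcup_measurable.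
  move=> m n mn; apply/subsetPset => x /= /le_trans; apply.
  by rewrite ler_nat.
rewrite (_ : \bigcup_k _ = setT); last first.
  rewrite -subTset => x _; exists (Num.bound `|S x|) => //=.
  by rewrite (le_trans (ler_norm _))// ltW// archi_boundP.
rewrite probability_setT => /fine_cvgP[_ /cvgrPdist_lt/(_ (1 - v))].
rewrite subr_gt0 => /(_ v1)[k _ /(_ k (leqnn _))]/= h.
exists k%:R; rewrite /pr; move: h.
by rewrite ltr_norml => /andP[_]; rewrite ltrD2l ltrN2.
Qed.

Lemma cdf_leaves (v : R) : 0 < v -> exists t, F t < v.
Proof.
move=> v0.
have mk (k : nat) : measurable [set x | S x <= - k%:R] by exact: measurable_Sle.
have : eta [set x | S x <= - k%:R] @[k --> \oo] --> eta (\bigcap_k [set x | S x <= - k%:R]).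
  apply: nonincreasing_cvg_mu => //.
  - by rewrite (le_lt_trans (probability_le1 _ _))// ltry.
  - exact: bigcap_measurable.
  move=> m n mn; apply/subsetPset => x /= /le_trans; apply.
  by rewrite lerN2 ler_nat.
rewrite (_ : \bigcap_k _ = set0); last first.
  apply/seteqP; split=> // x /(_ (Num.bound `|S x|).+1 Logic.I)/=.
  rewrite leNgt => /negP; apply.
  rewrite ltrNl (le_lt_trans (ler_norm _))// normrN.
  by rewrite (lt_trans (archi_boundP _))// ltr_nat.
rewrite measure0 => /fine_cvgP[_ /cvgrPdist_lt/(_ v v0)].
move=> [k _ /(_ k (leqnn _))]/= h.
exists (- k%:R); rewrite /pr; move: h.
by rewrite sub0r normrN ger0_norm// fine_ge0.
Qed.

Variable fY : R -> R.
Hypotheses (fY0 : forall y, 0 <= fY y) (mfY : measurable_fun setT fY).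
Hypothesis cdfE : forall t : R, cdfY eta S t =
  (\int[lebesgue_measure]_(y in `]-oo, t]) (fY y)%:E)%E.

Lemma cdf_increment a b : a <= b ->
  (F b)%:E = ((F a)%:E + \int[lebesgue_measure]_(y in `]a, b]) (fY y)%:E)%E.
Proof.
move=> ab; rewrite -!prE; [|exact: measurable_Sle..].
rewrite -!/(cdfY eta S _) !cdfE -ge0_integral_setU//=.
- by rewrite -itv_bndbnd_setU// bnd_simp.
- by apply/measurable_EFinP; exact: measurable_funS mfY.
- by move=> y _; rewrite lee_fin.
- apply/disj_setPS => y [/=]; rewrite !in_itv/= => ya /andP[ay _].
  by move: (lt_le_trans ay ya); rewrite ltxx.
Qed.

Lemma cdf_increment_le a b M : a <= b -> (forall y, a < y <= b -> fY y <= M) ->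
  F b <= F a + M * (b - a).
Proof.
move=> ab fM; rewrite -lee_fin (cdf_increment ab) EFinD leeD2l//.
apply: (@le_trans _ _ (\int[lebesgue_measure]_(y in `]a, b]) (cst M%:E y))%E).
  apply: ge0_le_integral_nomeas => y; rewrite /= in_itv/= lee_fin//.
  exact: fM.
rewrite integral_cst//= lebesgue_measure_itv/= lte_fin.
case: ltP => h; rewrite ?EFinM ?EFinB// mule0 lee_fin.
by rewrite (le_anti (introT andP (conj ab h))) subrr mulr0.
Qed.

Lemma cdf_increment_ge a b c : 0 <= c -> a <= b ->
  (forall y, a < y <= b -> c <= fY y) -> F a + c * (b - a) <= F b.
Proof.
move=> c0 ab fc; rewrite -lee_fin (cdf_increment ab) EFinD leeD2l//.
apply: (@le_trans _ _ (\int[lebesgue_measure]_(y in `]a, b]) (cst c%:E y))%E).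
  rewrite integral_cst//= lebesgue_measure_itv/= lte_fin.
  case: ltP => h; rewrite ?EFinM ?EFinB// mule0 lee_fin.
  by rewrite (le_anti (introT andP (conj ab h))) subrr mulr0.
apply: ge0_le_integral_nomeas => y; rewrite /= in_itv/= lee_fin//.
exact: fc.
Qed.

Variable p : nat.
Local Notation l := (Lq eta S alpha p).
Hypotheses (fYc : {for l, continuous fY}) (fYl : 0 < fY l).

(** Near the level the density stays between half and twice its value there. The upper slope
    excludes an atom of Y at the level; the lower slope excludes a plateau of its cdf. *)
Lemma cdf_near : exists dlt c M : R, [/\ 0 < dlt, 0 < c, 0 < M &
  forall a b, l - dlt < a -> a <= b -> b < l + dlt ->
    F a + c * (b - a) <= F b <= F a + M * (b - a)].
Proof.
have c0 : 0 < fY l / 2 by rewrite divr_gt0.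
move: fYc => /cvgrPdist_lt/(_ _ c0)/nbhs_ballP[dlt /= d0 hd].
have key y : `|l - y| < dlt -> fY l / 2 <= fY y <= 2 * fY l.
  move=> /hd/=; rewrite ltr_norml => /andP[h1 h2]; apply/andP; split; lra.
exists dlt, (fY l / 2), (2 * fY l); split=> //; first by rewrite mulr_gt0.
move=> a b h1 ab h2; apply/andP; split.
  apply: cdf_increment_ge => //; first exact: ltW.
  move=> y /andP[ay yb]; suff /andP[]// : fY l / 2 <= fY y <= 2 * fY l by [].
  by apply: key; rewrite ltr_norml; apply/andP; split; lra.
apply: cdf_increment_le => // y /andP[ay yb].
suff /andP[]// : fY l / 2 <= fY y <= 2 * fY l by [].
by apply: key; rewrite ltr_norml; apply/andP; split; lra.
Qed.

Let v := 1 - alpha ^+ p.+1.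
Let E := [set t : R | ((1 - alpha ^+ p.+1)%:E <= cdfY eta S t)%E].

Let EE t : E t = (v <= F t).
Proof. by rewrite /E/= /cdfY prE ?lee_fin//; exact: measurable_Sle. Qed.

Let v01 : 0 < v < 1.
Proof.
have /andP[a0 a1] := alpha01.
by rewrite subr_gt0 exprn_ilt1 ?ltW//= gtrBl exprn_gt0.
Qed.

Let infE : has_inf E.
Proof.
have /andP[v0 v1] := v01; split.
  by have [t vt] := cdf_reaches v1; exists t; rewrite EE ltW.
have [t vt] := cdf_leaves v0; exists t => y; rewrite EE => vy.
rewrite leNgt; apply/negP => yt.
by have := lt_le_trans vt (le_trans vy (cdf_le (ltW yt))); rewrite ltxx.
Qed.

Lemma cdf_below e : 0 < e -> F (l - e) < 1 - alpha ^+ p.+1.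
Proof.
move=> e0; rewrite ltNge; apply/negP => h.
have {}h : E (l - e) by rewrite EE.
have := ge_inf infE.2 h; rewrite -/(Lq eta S alpha p) => h'; lra.
Qed.

Let cdf_ge e : 0 < e -> v <= F (l + e).
Proof.
move=> e0; have [t Et tl] := inf_adherent e0 infE.
by rewrite EE in Et; apply: le_trans Et (cdf_le (ltW tl)).
Qed.

(** The infimum places the target value between F(l - r) and F(l + r) for every r > 0, and the upper
    slope rules out a jump. *)
Lemma cdf_level : F l = 1 - alpha ^+ p.+1.
Proof.
have [dlt [c [M [d0 c0 M0 h]]]] := cdf_near.
apply/eqP; rewrite eq_le; apply/andP; split; apply/ler_addgt0Pr => e e0.
  (* Small enough to stay in the window of [cdf_near] and to keep the increment M r below [e]. *)
  pose r := Num.min (dlt / 2) (e / M).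
  have r0 : 0 < r by rewrite lt_min !divr_gt0.
  have r1 : r <= dlt / 2 by rewrite ge_min lexx.
  have r2 : r <= e / M by rewrite ge_min lexx orbT.
  have Fr := cdf_below r0.
  have /andP[_] : F (l - r) + c * (l - (l - r)) <= F l <= F (l - r) + M * (l - (l - r)).
    by apply: h; lra.
  have -> : M * (l - (l - r)) = r * M by ring.
  move: r2; rewrite ler_pdivlMr//; lra.
pose r := Num.min (dlt / 2) (e / M).
have r0 : 0 < r by rewrite lt_min !divr_gt0.
have r1 : r <= dlt / 2 by rewrite ge_min lexx.
have r2 : r <= e / M by rewrite ge_min lexx orbT.
have := cdf_ge r0; rewrite -/v.
have /andP[_] : F l + c * (l + r - l) <= F (l + r) <= F l + M * (l + r - l).
  by apply: h; lra.
have -> : M * (l + r - l) = r * M by ring.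
move: r2; rewrite ler_pdivlMr//; lra.
Qed.

(** Unlike [cdf_below], which follows from the infimum alone, strictness on this side rests on the
    positive lower slope. *)
Lemma cdf_above e : 0 < e -> 1 - alpha ^+ p.+1 < F (l + e).
Proof.
move=> e0; have [dlt [c [M [d0 c0 M0 h]]]] := cdf_near.
rewrite -cdf_level.
pose r := Num.min (dlt / 2) e.
have r0 : 0 < r by rewrite lt_min e0 divr_gt0.
have r1 : r <= dlt / 2 by rewrite ge_min lexx.
have r2 : r <= e by rewrite ge_min lexx orbT.
apply: (@lt_le_trans _ _ (F (l + r))); last by apply: cdf_le; rewrite lerD2l.
have /andP[+ _] : F l + c * (l + r - l) <= F (l + r) <= F l + M * (l + r - l).
  by apply: h; lra.
rewrite (_ : l + r - l = r); last by rewrite addrC addKr.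
by apply: lt_le_trans; rewrite ltrDl mulr_gt0.
Qed.

Lemma pr_level_near g : 0 < g ->
  exists2 e, 0 < e & pr [set x | `|S x - l| <= e] <= g.
Proof.
move=> g0; have [dlt [c [M [d0 c0 M0 h]]]] := cdf_near.
pose r := Num.min (dlt / 3) (g / (3 * M)).
have M30 : 0 < 3 * M by rewrite mulr_gt0.
have r0 : 0 < r by rewrite lt_min !divr_gt0.
have r1 : r <= dlt / 3 by rewrite ge_min lexx.
have r2 : r <= g / (3 * M) by rewrite ge_min lexx orbT.
exists r => //.
(* The closed shell contains {S = l - r}, which the increment of the cdf from l - r to l + r misses.
   Starting at l - 2r includes it; the length 3r explains the factors 3 in [r]. *)
have : F (l + r) <= F (l - 2 * r) + M * (l + r - (l - 2 * r)).
  suff /andP[] : F (l - 2 * r) + c * (l + r - (l - 2 * r)) <= F (l + r) <=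
    F (l - 2 * r) + M * (l + r - (l - 2 * r)) by [].
  by apply: h; lra.
rewrite (_ : l + r - (l - 2 * r) = 3 * r); last by ring.
move: r2; rewrite ler_pdivlMr// => r2.
have -> : M * (3 * r) = r * (3 * M) by ring.
have mA := measurable_Sle (l + r); have mB := measurable_Sle (l - 2 * r).
rewrite (pr_split mA mB).
have -> : [set x | S x <= l + r] `&` [set x | S x <= l - 2 * r] = [set x | S x <= l - 2 * r].
  apply/seteqP; split => x /=; first by case.
  by move=> hx; split=> //; apply: le_trans hx _; lra.
have : pr [set x | `|S x - l| <= r] <=
    pr ([set x | S x <= l + r] `&` ~` [set x | S x <= l - 2 * r]).
  apply: pr_le.
  - exact: measurable_Snear.
  - by apply: measurableI => //; exact: measurableC.
  - move=> x /=; rewrite ler_norml => /andP[h1 h2]; split; first lra.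
    by apply/negP; rewrite -ltNge; lra.
lra.
Qed.

(** The cdf gives the mass of the strict superlevel set; {S = l} adds nothing, being contained in
    shells of arbitrarily small mass. *)
Lemma pr_level_ge : pr [set x | l <= S x] = alpha ^+ p.+1.
Proof.
apply/eqP; rewrite eq_le; apply/andP; split.
  apply/ler_addgt0Pr => g g0; have [e e0 he] := pr_level_near g0.
  have : pr [set x | l <= S x] <=
      pr ([set x | l < S x] `|` [set x | `|S x - l| <= e]).
    apply: pr_le; first exact: measurable_Sge.
      by apply: measurableU; [exact: measurable_Sgt|exact: measurable_Snear].
    move=> x /=; rewrite le_eqVlt => /predU1P[<-|]; last by left.
    by right; rewrite subrr normr0 ltW.
  have := prU (measurable_Sgt l) (measurable_Snear l e).
  rewrite pr_gt cdf_level; lra.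
have : pr [set x | l < S x] <= pr [set x | l <= S x].
  apply: pr_le; [exact: measurable_Sgt|exact: measurable_Sge|].
  by move=> x /= /ltW.
by rewrite pr_gt cdf_level; lra.
Qed.

End level_facts.

(** * Masses of sets near a level under the limit measures *)

Section level_sets.
Context {R : realType} {d : nat}.
Local Notation V := 'rV[R]_d.
Variables (eta : probability V R) (S : V -> R) (alpha : R) (n : nat) (fY : R -> R).

Definition lset (p : nat) : set V :=
  if p is p'.+1 then [set x | Lq eta S alpha p' <= S x] else setT.

Definition regular_levels : Prop :=
  [/\ measurable_fun setT S, 0 < alpha < 1,
   (forall y, 0 <= fY y) /\ measurable_fun setT fY,
   (forall t : R, cdfY eta S t =
     (\int[lebesgue_measure]_(y in `]-oo, t]) (fY y)%:E)%E) &
   (forall p, (p <= n)%N ->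
     {for Lq eta S alpha p, continuous fY} /\ 0 < fY (Lq eta S alpha p))].

Hypothesis HL : regular_levels.

Local Notation l p := (Lq eta S alpha p).
Local Notation pr := (pr eta).
Local Notation W p e := [set x | `|S x - l p| <= e].
Local Notation wI p := (wint eta (alpha ^- p) (lset p)).

Let mS : measurable_fun setT S. Proof. by case: HL. Qed.
Let alpha01 : 0 < alpha < 1. Proof. by case: HL. Qed.
Let a0 : 0 < alpha. Proof. by case/andP: alpha01. Qed.
Let fY0 y : 0 <= fY y. Proof. by case: HL => _ _ []. Qed.
Let mfY : measurable_fun setT fY. Proof. by case: HL => _ _ []. Qed.
Let cdfE t : cdfY eta S t = (\int[lebesgue_measure]_(y in `]-oo, t]) (fY y)%:E)%E.
Proof. by case: HL. Qed.
Let fYc p : (p <= n)%N -> {for l p, continuous fY}.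
Proof. by case: HL => _ _ _ _ h /h[]. Qed.
Let fYl p : (p <= n)%N -> 0 < fY (l p).
Proof. by case: HL => _ _ _ _ h /h[]. Qed.

Let an_gt0 p : 0 < alpha ^- p.
Proof. by rewrite invr_gt0 exprn_gt0. Qed.

Lemma measurable_lset p : measurable (lset p).
Proof. by case: p => [|p]; [exact: measurableT|exact: (measurable_Sge mS)]. Qed.
Hint Resolve measurable_lset : core.

Lemma lset_mass p : (p <= n.+1)%N -> pr (lset p) = alpha ^+ p.
Proof.
case: p => [_|p pn]; first by rewrite prT expr0.
exact: (pr_level_ge mS alpha01 fY0 mfY cdfE (fYc pn) (fYl pn)).
Qed.

Lemma wint_mass p : (p <= n.+1)%N -> alpha ^- p * fine (eta (lset p)) = 1.
Proof.
move=> pn; rewrite -[fine _]/(pr _) lset_mass//.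
by rewrite mulVf// expf_neq0// gt_eqF.
Qed.

Lemma level_lt p : (p < n)%N -> l p < l p.+1.
Proof.
move=> pn; rewrite ltNge; apply/negP => /(cdf_le eta mS).
rewrite (cdf_level mS alpha01 fY0 mfY cdfE (fYc pn) (fYl pn)).
rewrite (cdf_level mS alpha01 fY0 mfY cdfE (fYc (ltnW pn)) (fYl (ltnW pn))).
rewrite lerD2l lerN2 => h; have : alpha ^+ p.+2 < alpha ^+ p.+1.
  by rewrite [ltLHS]exprS gtr_pMl ?exprn_gt0//; case/andP: alpha01.
by move=> /(le_lt_trans h); rewrite ltxx.
Qed.

Lemma level_in_lset p x : (p <= n)%N -> l p <= S x -> lset p x.
Proof.
by case: p => [//|p] pn /=; apply: le_trans; exact/ltW/level_lt.
Qed.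

Lemma wI_indic p (B : set V) : measurable B ->
  wI p \1_B = alpha ^- p * pr (B `&` lset p).
Proof. by move=> mB; rewrite wint_indic. Qed.

Lemma wI_indic01 p (B : set V) : (p <= n.+1)%N -> measurable B ->
  0 <= wI p \1_B <= 1.
Proof.
move=> pn mB; rewrite wI_indic//; apply/andP; split.
  by rewrite mulr_ge0 ?pr_ge0// ltW.
rewrite mulrC ler_pdivrMr ?exprn_gt0// mul1r -lset_mass//.
by apply: pr_le => //; exact: measurableI.
Qed.

Lemma wI_indic_le p (B : set V) : measurable B -> wI p \1_B <= alpha ^- p * pr B.
Proof.
move=> mB; rewrite wI_indic// ler_pM2l//.
by apply: pr_le => //; exact: measurableI.
Qed.

Lemma wI_above p e : (p <= n)%N -> 0 < e -> wI p \1_[set x | l p + e < S x] < alpha.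
Proof.
move=> pn e0; apply: le_lt_trans (wI_indic_le _ (measurable_Sgt mS _)) _.
rewrite pr_gt// mulrC ltr_pdivrMr ?exprn_gt0// -exprS.
have := cdf_above mS alpha01 fY0 mfY cdfE (fYc pn) (fYl pn) e0; lra.
Qed.

Lemma wI_below p e : (p <= n)%N -> 0 < e ->
  wI p \1_[set x | S x <= l p - e] < 1 - alpha.
Proof.
move=> pn e0; have mB := measurable_Sle mS (l p - e).
rewrite wI_indic// mulrC ltr_pdivrMr ?exprn_gt0//.
(* The radius is arbitrary, so l_p - e may fall below the previous level, and then the mass can
   vanish. Otherwise a common point forces {S > l_p - e} into [lset p], and [cdf_below] gives its
   mass. *)
have [ [x [xS xl]]|h] := pselect (exists x, S x <= l p - e /\ lset p x); last first.
  rewrite (_ : _ `&` _ = set0) ?pr0.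
    by rewrite mulr_gt0 ?exprn_gt0// subr_gt0; case/andP: alpha01.
  by rewrite -subset0 => x [? ?]; apply: h; exists x.
have sub : [set x | l p - e < S x] `<=` lset p.
  move=> y /= hy; case: (p) xS xl hy => [//|q] /= h1 h2 h3.
  by apply: le_trans h2 _; apply: le_trans h1 (ltW h3).
have := pr_split eta (measurable_lset p) mB.
rewrite lset_mass ?(leqW pn)// setIC => h.
rewrite mulrBl mul1r -exprS h.
have : pr [set x | l p - e < S x] <=  pr (lset p `&` ~` [set x | S x <= l p - e]).
  apply: pr_le; first exact: measurable_Sgt.
    by apply: measurableI => //; exact: measurableC.
  by move=> y /= hy; split; [exact: sub|apply/negP; rewrite -ltNge].
have := cdf_below eta mS alpha01 p e0.
rewrite pr_gt//; lra.
Qed.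

(** Read through the complement, this bounds from below the fraction of particles that survive
    selection; [wI_select] bounds the numerator of the weights. *)
Lemma wI_near p e : (p <= n)%N -> 0 < e ->
  wI p \1_[set x | S x <= l p + e] <= 1 - alpha + alpha ^- p * pr (W p e).
Proof.
move=> pn e0; have mB := measurable_Sle mS (l p + e).
have mW := measurable_Snear mS (l p) e.
rewrite wI_indic//; have h := pr_split eta (measurable_lset p) mB.
rewrite setIC (_ : pr _ = alpha ^+ p - pr (lset p `&` ~` [set x | S x <= l p + e])); last first.
  by rewrite -lset_mass ?(leqW pn)// h addrK.
rewrite mulrBr mulVf ?expf_neq0 ?gt_eqF// -addrA lerD2l.
rewrite lerNl opprD opprK lerBlDr -(ler_pM2l (exprn_gt0 p a0)) -exprSr.
rewrite mulrDr !mulVKf ?expf_neq0 ?gt_eqF//.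
rewrite -lset_mass//=.
apply: le_trans (prU _ _ _) => //; last first.
  by apply: measurableI => //; exact: measurableC.
apply: pr_le; first exact: measurable_Sge.
  by apply: measurableU => //; apply: measurableI => //; exact: measurableC.
move=> x /= lx; have [h1|h1] := leP (S x) (l p + e).
  by right; rewrite ger0_norm ?subr_ge0// lerBlDl.
by left; split=> //; exact: level_in_lset.
Qed.

(** Passing from {S > l_p - e} to {S >= l_p} loses only part of the shell; the factor [alpha] is the
    change of normalisation between consecutive levels. *)
Lemma wI_select p e (B : set V) : (p <= n)%N -> measurable B ->
  wI p \1_(B `&` [set x | l p - e < S x]) <=
  alpha * wI p.+1 \1_B + alpha ^- p * pr (W p e).
Proof.
move=> pn mB; have mG := measurable_Sgt mS (l p - e).
have mW := measurable_Snear mS (l p) e.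
have mBL : measurable (B `&` lset p.+1) by exact: measurableI.
rewrite wI_indic; last exact: measurableI.
rewrite wI_indic// exprS invfM mulrA mulrA mulfV ?gt_eqF// mul1r -mulrDr.
rewrite ler_pM2l//; apply: le_trans (prU _ _ _) => //.
apply: pr_le => //; [|exact: measurableU|].
  by apply: measurableI => //; exact: measurableI.
move=> x [[Bx /= h1] h2]; have [h3|h3] := leP (l p) (S x); first by left.
by right; rewrite ler_norml; apply/andP; split; lra.
Qed.

Lemma level_radius p g : (p <= n)%N -> 0 < g ->
  exists2 e, 0 < e & alpha ^- p * pr (W p e) <= g.
Proof.
move=> pn g0; have g1 : 0 < g * alpha ^+ p by rewrite mulr_gt0// exprn_gt0.
have [e e0 he] := pr_level_near mS fY0 mfY cdfE (fYc pn) (fYl pn) g1.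
by exists e => //; rewrite mulrC ler_pdivrMr// exprn_gt0.
Qed.

End level_sets.

(** * The particle system *)

Section filtration.
Context {R : realType} {d : nat} {dO : measure_display} {T : measurableType dO}.
Local Notation V := 'rV[R]_d.
Variables (X : forall N : nat, nat -> 'I_N -> T -> V).
Variables (U : forall N : nat, nat -> 'I_N -> T -> R).
Variables (Xh : forall N : nat, nat -> 'I_N -> T -> V).
Implicit Types (N p k : nat).

(** The sample space carrying the history as its sigma-algebra, so that ordinary measurability
    lemmas show an event to belong to the past. *)
Definition hist N p k := g_sigma_algebraType (hist_gen X U Xh N p k).

Lemma measurable_hist_X N p k q (i : 'I_N) : (q <= p)%N ->
  measurable_fun setT (X q i : hist N p k -> V).
Proof.
move=> qp _ B mB; rewrite setTI; apply: sub_sigma_algebra.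
by left; exists q, i, B.
Qed.

Lemma measurable_hist_Xh N p k q (i : 'I_N) : (q < k)%N ->
  measurable_fun setT (Xh q i : hist N p k -> V).
Proof.
move=> qp _ B mB; rewrite setTI; apply: sub_sigma_algebra.
by right; right; exists q, i, B.
Qed.

Lemma measurable_emp d' (T' : measurableType d') N (Y : 'I_N -> T' -> V) (f : V -> R) :
  measurable_fun setT f -> (forall i, measurable_fun setT (Y i)) ->
  measurable_fun setT (fun w => emp N (Y ^~ w) f).
Proof.
move=> mf mY; apply: measurable_funM => //.
by apply: measurable_sum => i; exact: measurableT_comp (mY i).
Qed.

Lemma hist_X_lt N p k q (f : V -> R) (c : R) : (q <= p)%N -> measurable_fun setT f ->
  <<s hist_gen X U Xh N p k >> [set w | emp N (X q ^~ w) f < c].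
Proof.
move=> qp mf.
rewrite -[<<s _ >> _]/((measurable : set (set (hist N p k))) _).
apply: measurable_lt_set => //.
by apply: (@measurable_emp _ (hist N p k)) => // i; exact: measurable_hist_X.
Qed.

Lemma hist_Xh_lt N p k q (f : V -> R) (c : R) : (q < k)%N -> measurable_fun setT f ->
  <<s hist_gen X U Xh N p k >> [set w | emp N (Xh q ^~ w) f < c].
Proof.
move=> qp mf.
rewrite -[<<s _ >> _]/((measurable : set (set (hist N p k))) _).
apply: measurable_lt_set => //.
by apply: (@measurable_emp _ (hist N p k)) => // i; exact: measurable_hist_Xh.
Qed.

Lemma histI N p k (E E' : set T) : <<s hist_gen X U Xh N p k >> E ->
  <<s hist_gen X U Xh N p k >> E' -> <<s hist_gen X U Xh N p k >> (E `&` E').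
Proof. exact: (@measurableI _ (hist N p k)). Qed.

Lemma histT N p k : <<s hist_gen X U Xh N p k >> setT.
Proof. exact: (@measurableT _ (hist N p k)). Qed.

Lemma hist_mono N p k p' k' : (p <= p')%N -> (k <= k')%N ->
  <<s hist_gen X U Xh N p k >> `<=` <<s hist_gen X U Xh N p' k' >>.
Proof.
move=> pp kk; apply: sub_sigma_algebra2 => E [|[|]] [q [i [B [qp mB]]]].
- by left; exists q, i, B; rewrite (leq_trans qp).
- by right; left; exists q, i, B; rewrite (leq_trans qp).
- by right; right; exists q, i, B; rewrite (leq_trans qp).
Qed.

Lemma hist_measurable N p k :
  (forall p i, measurable_fun setT (@X N p i)) ->
  (forall p i, measurable_fun setT (@U N p i)) ->
  (forall p i, measurable_fun setT (@Xh N p i)) ->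
  <<s hist_gen X U Xh N p k >> `<=` measurable.
Proof.
move=> mX mU mXh; apply: smallest_sub; first exact: sigma_algebra_measurable.
move=> E [|[|]] [q [i [B [qp [mB ->]]]]]; rewrite -[_ @^-1` _]setTI.
- exact: mX.
- exact: mU.
- exact: mXh.
Qed.

End filtration.

(** Rounding loses less than 1, which the gap N (1 - alpha - c) eventually covers. *)
Lemma qrank_large {R : realType} (alpha c : R) : 0 < alpha < 1 -> c < 1 - alpha ->
  \forall N \near \oo, N%:R * c < (qrank alpha N)%:R.
Proof.
move=> /andP[a0 a1] ca; have k0 : 0 < 1 - alpha - c by rewrite subr_gt0.
exists (Num.bound (1 - alpha - c)^-1) => // N /=.
rewrite -(ler_nat R) => hN.
have : 1 <= N%:R * (1 - alpha - c).
  rewrite -ler_pdivrMr// div1r; apply: le_trans hN; apply: ltW.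
  by rewrite archi_boundP// invr_ge0 ltW.
have : N%:R * (1 - alpha) < (qrank alpha N).+1%:R by rewrite truncnS_gt.
rewrite -natr1; lra.
Qed.

Section concentration_step.
Context {R : realType} {d : nat} {dO : measure_display} {T : measurableType dO}.
Local Notation V := 'rV[R]_d.
Variable Pr : probability T R.

(* [q N i] bounds the conditional probability, given the past, that particle [i]
   falls in [B]. *)
Lemma conc_step (Y : forall N, 'I_N -> T -> V) (E : nat -> set T)
    (q : forall N, 'I_N -> T -> R) (B : set V) (c1 c2 : R) :
  0 <= c1 < c2 -> measurable B -> small Pr (fun N => ~` E N) ->
  (\forall N \near \oo, [/\ measurable (E N) /\ (forall i, measurable_fun setT (@Y N i)),
     forall i, measurable_fun setT (@q N i), forall i w, 0 <= @q N i w,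
     forall J : {set 'I_N},
       (Pr (E N `&` \bigcap_(i in [set i | i \in J]) (@Y N i @^-1` B)) <=
        \int[Pr]_(w in E N) (\prod_(i in J) @q N i w)%:E)%E &
     forall w, E N w -> \sum_(i < N) @q N i w <= N%:R * c1]) ->
  small Pr (fun N => [set w | c2 <= emp N (@Y N ^~ w) \1_B]).
Proof.
move=> c12 mB sE HE; have [rho rho01 hrho] := chernoff Pr c12.
have mind N (Y' : 'I_N -> T -> V) : (forall i, measurable_fun setT (Y' i)) ->
    measurable_fun setT (fun w => emp N (Y' ^~ w) \1_B).
  by move=> mY; apply: measurable_emp => //; exact: measurable_indic.
apply: (@small_sub _ _ _ _ _ (fun N => ~` E N `|`
    (E N `&` [set w | c2 <= emp N (@Y N ^~ w) \1_B]))).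
  apply: nearW => N w h; have [Ew|nEw] := pselect (E N w); last by left.
  by right.
apply: small_setU => //; apply: (small_geometric rho01).
case: HE => N1 _ HE; near=> N.
have NN1 : (N1 <= N)%N by near: N; exists N1.
have [[mE mY] mq q0 HJ Hs] := HE N NN1.
have N0 : (0 < N)%N by near: N; exists 1%N.
split.
  apply: measurableI => //; apply: measurable_le_set => //; exact: mind.
apply: le_trans (hrho N (E N) (fun i => @Y N i @^-1` B) (@q N) mE _ mq q0 HJ Hs); last first.
  by move=> i; rewrite -[_ @^-1` _]setTI; exact: mY.
apply: le_measure; rewrite ?inE.
- by apply: measurableI => //; apply: measurable_le_set => //; exact: mind.
- apply: measurableI => //; apply: measurable_le_set => //.
  apply: measurable_sum => i; apply: measurable_indic.
  by rewrite -[_ @^-1` _]setTI; exact: mY.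
apply: setIS => w /=; rewrite /emp ler_pdivlMl ?ltr0n//.
Unshelve. all: by end_near. Qed.

End concentration_step.

Section ams.
Context {R : realType} {d : nat} {dO : measure_display} {T : measurableType dO}.
Local Notation V := 'rV[R]_d.
Variables (eta : probability V R) (S : V -> R) (alpha : R) (n : nat) (fY : R -> R).
Variables (K : nat -> R.-pker V ~> V) (Pr : probability T R).
Variables (X : forall N : nat, nat -> 'I_N -> T -> V).
Variables (U : forall N : nat, nat -> 'I_N -> T -> R).
Variables (Xh : forall N : nat, nat -> 'I_N -> T -> V).

Hypothesis HL : regular_levels eta S alpha n fY.
Hypothesis HA : is_AMS S alpha X U Xh Pr eta K.

Local Notation l p := (Lq eta S alpha p).
Local Notation pr := (pr eta).
Local Notation W p e := [set x | `|S x - l p| <= e].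
Local Notation lset := (lset eta S alpha).
Local Notation wI p := (wint eta (alpha ^- p) (lset p)).
Local Notation LN := (LN S alpha X U).
Local Notation above := (above S alpha X U).
Local Notation concX p := (conc Pr eta (alpha ^- p) (lset p) (fun N => @X N p)).
Local Notation concXh p := (conc Pr eta (alpha ^- p.+1) (lset p.+1) (fun N => @Xh N p)).

Let mS : measurable_fun setT S. Proof. by case: HL. Qed.
Let alpha01 : 0 < alpha < 1. Proof. by case: HL. Qed.
Let a0 : 0 < alpha. Proof. by case/andP: alpha01. Qed.
Let a1 : alpha < 1. Proof. by case/andP: alpha01. Qed.

Lemma qrank_gt0_near : \forall N \near \oo, (1 <= qrank alpha N)%N.
Proof.
have : 0 < 1 - alpha by rewrite subr_gt0.
move=> /(qrank_large alpha01); apply: filterS => N.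
by rewrite mulr0 ltr0n.
Qed.

Let N_gt0 N : (1 <= qrank alpha N)%N -> (0 < N)%N.
Proof. by move=> h; apply: leq_trans h _; exact: qrank_le. Qed.

Lemma X_measurable N p i : (1 <= qrank alpha N)%N -> measurable_fun setT (@X N p i).
Proof. by move=> /HA[[]]. Qed.

Lemma Xh_measurable N p i : (1 <= qrank alpha N)%N -> measurable_fun setT (@Xh N p i).
Proof. by move=> /HA[[_ []]]. Qed.

Lemma ams_hist_measurable N p k : (1 <= qrank alpha N)%N ->
  <<s hist_gen X U Xh N p k >> `<=` measurable.
Proof. by move=> /HA[[h1 [h2 h3]] _ _ _]; exact: hist_measurable. Qed.

(** The laws in [is_AMS] prescribe sets for all particles at once; the full space for indices
    outside [J] extracts the joint probabilities over [J] that the Chernoff bound asks for. *)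
Let set_indices N (Y : 'I_N -> T -> V) (J : {set 'I_N}) (B : set V) :
  \bigcap_(i in [set: 'I_N]) (Y i @^-1` (if i \in J then B else setT)) =
  \bigcap_(i in [set i | i \in J]) (Y i @^-1` B).
Proof.
apply/seteqP; split => w h i.
  by move=> /= iJ; have /= := h i Logic.I; rewrite iJ.
by move=> _ /=; case: ifPn => // iJ; exact: (h i iJ).
Qed.

Let unit_mass : fine (@lebesgue_measure R (setT `&` `[0, 1])) = 1.
Proof. by rewrite setTI lebesgue_measure_itv/= lte_fin ltr01 oppr0 adde0. Qed.

Lemma init_prob N (B : set V) (J : {set 'I_N}) :
  (1 <= qrank alpha N)%N -> measurable B ->
  (Pr (\bigcap_(i in [set i | i \in J]) (X 0 i @^-1` B)) <=
   (\prod_(i in J) pr B)%:E)%E.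
Proof.
move=> q1 mB; rewrite -set_indices.
have [_ hinit _ _] := HA q1.
have := hinit (fun i => if i \in J then B else setT) (fun=> setT).
under eq_bigcapr do rewrite preimage_setT setIT.
move=> -> //; last by move=> i; case: ifP.
rewrite lee_fin [leRHS]big_mkcond/=.
apply: ler_prod => i _; rewrite unit_mass mulr1.
by case: ifP => _; rewrite ?probability_setT /= ?lexx ?ler01// fine_ge0/=.
Qed.

Lemma conc_init : concX 0.
Proof.
move=> B mB e e0.
have p0 := pr_ge0 eta B.
have wE : wI 0 \1_B = pr B by rewrite wint_indic//= setIT expr0 invr1 mul1r.
rewrite wE; apply: (@conc_step _ _ _ _ _ _ (fun=> setT) (fun _ _ _ => pr B) _ (pr B)).
- by rewrite p0 ltrDl.
- exact: mB.
- by under [X in small _ X]eq_fun do rewrite setCT; exact: small_set0.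
apply: filterS qrank_gt0_near => N q1; split=> //.
- by split=> // i; exact: X_measurable.
- move=> J; rewrite setTI integral_cst//= probability_setT mule1.
  exact: init_prob.
- by move=> w _; rewrite sumr_const card_ord mulr_natl.
Qed.

(** The event is stated through empirical masses of two fixed sets instead of the quantile, which
    places it in the history without any measurability of [LN]. *)
Lemma quantile_event p e : (p <= n)%N -> concX p -> 0 < e ->
  exists G : nat -> set T, [/\ forall N, Fhist X U Xh N p (G N),
    small Pr (fun N => ~` G N) &
    \forall N \near \oo, forall w, G N w -> l p - e < LN N p w <= l p + e].
Proof.
move=> pn cX e0.
have mB := measurable_Sle mS (l p - e); have mC := measurable_Sgt mS (l p + e).
have hB := wI_below HL pn e0; have hC := wI_above HL pn e0.
pose B := [set x | S x <= l p - e]; pose C := [set x | l p + e < S x].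
(* The midpoint leaves room for the rounding in [qrank]. The other side can use [alpha] itself,
   since the rounding goes down. *)
pose c := (wI p \1_B + (1 - alpha)) / 2.
exists (fun N => [set w | emp N (X p ^~ w) \1_B < c] `&`
                 [set w | emp N (X p ^~ w) \1_C < alpha]); split.
- by move=> N; apply: histI; apply: hist_X_lt => //; exact: measurable_indic.
- have e1 : 0 < (1 - alpha - wI p \1_B) / 2 by rewrite divr_gt0// subr_gt0.
  have e2 : 0 < alpha - wI p \1_C by rewrite subr_gt0.
  apply: small_sub (small_setU (cX B mB _ e1) (cX C mC _ e2)).
  apply: nearW => N w; rewrite setCI => -[/negP|/negP]; rewrite -leNgt => h; [left|right] => /=.
    by apply: le_trans h; rewrite /c; lra.
  by apply: le_trans h; lra.
- have c1 : c < 1 - alpha by rewrite /c; rewrite -/B in hB; lra.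
  near=> N => w [/= h1 h2].
  have q1 : (1 <= qrank alpha N)%N by near: N; exact: qrank_gt0_near.
  have N0 := N_gt0 q1; have NR0 : 0 < N%:R :> R by rewrite ltr0n.
  apply/andP; split.
    apply: LN_gt => //; apply: (@lt_trans _ _ (N%:R * c)); first by rewrite ltr_pM2l.
    by near: N; exact: qrank_large.
  apply: LN_le => //; apply: (@le_trans _ _ (N%:R * (1 - alpha))).
    by rewrite truncn_le// mulr_ge0// subr_ge0 ltW.
  rewrite ler_pM2l// (_ : [set x | _] = ~` C).
    by rewrite emp_indicC//; lra.
  by apply/seteqP; split => x /=; rewrite leNgt => /negP.
Unshelve. all: by end_near. Qed.

(** * Selection *)

Let weight N p w (B : set V) : R := #|[pred j | above N p w j]|%:R^-1 *
  \sum_(j < N | above N p w j) (\1_B (X p j w) : R).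

(** In both numerator and denominator, one [g] pays for the shell around the level and one for the
    empirical error. The bound on the number of survivors is kept for [domination]. *)
Lemma selection_event p (B : set V) g : (p <= n)%N -> concX p -> measurable B ->
  0 < g -> 2 * g < alpha ->
  exists G : nat -> set T, [/\ forall N, Fhist X U Xh N p (G N),
    small Pr (fun N => ~` G N) &
    \forall N \near \oo, forall w, G N w ->
      weight N p w B <= (alpha * wI p.+1 \1_B + 2 * g) / (alpha - 2 * g) /\
      N%:R * (alpha - 2 * g) <= #|[pred j | above N p w j]|%:R].
Proof.
move=> pn cX mB g0 ga; have [e e0 he] := level_radius HL pn g0.
have [G [FG sG HG]] := quantile_event pn cX e0.
pose C := [set x | S x <= l p + e]; pose D := B `&` [set x | l p - e < S x].
have mC : measurable C := measurable_Sle mS (l p + e).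
have mD : measurable D by apply: measurableI => //; exact: measurable_Sgt.
have hC := wI_near HL pn e0; have hD := wI_select HL e pn mB.
exists (fun N => G N `&` ([set w | emp N (X p ^~ w) \1_C < wI p \1_C + g] `&`
                 [set w | emp N (X p ^~ w) \1_D < wI p \1_D + g])); split.
- move=> N; apply: histI; first exact: FG.
  by apply: histI; apply: hist_X_lt => //; exact: measurable_indic.
- apply: small_sub (small_setU sG (small_setU (cX C mC g g0) (cX D mD g g0))).
  apply: nearW => N w; rewrite !setCI => -[h|[/negP h|/negP h]];
    [by left|right; left|right; right]; by rewrite /= leNgt.
- near=> N => w [Gw [/= h1 h2]].
  have q1 : (1 <= qrank alpha N)%N by near: N; exact: qrank_gt0_near.
  have N0 := N_gt0 q1.
  have /(_ w Gw) hL : forall w, G N w -> l p - e < LN N p w <= l p + e by near: N.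
  have hCC : alpha - 2 * g < emp N (X p ^~ w) \1_[set x | l p + e < S x].
    rewrite (_ : [set x | _] = ~` C); last first.
      by apply/seteqP; split => x /=; rewrite ltNge => /negP.
    by rewrite emp_indicC//; rewrite -/C in hC; lra.
  have ag0 : 0 < alpha - 2 * g by rewrite subr_gt0.
  split; last first.
    case/andP: hL => _ hL; apply: le_trans (card_above_ge N0 hL).
    by rewrite ler_pM2l ?ltr0n// ltW.
  apply: le_trans (selection_weight_le _ N0 hL _) _; first exact: lt_trans hCC.
  apply: ler_pM.
  + by apply: emp_ge0 => x; rewrite indicE ler0n.
  + by rewrite invr_ge0 ltW// (lt_trans _ hCC).
  + by rewrite -/D; rewrite -/D in hD; lra.
  + by rewrite lef_pV2 ?posrE ?(ltW hCC)// (lt_trans _ hCC).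
Unshelve. all: by end_near. Qed.

(** The bound [c] may depend on the outcome: it is a constant for concentration, but a multiple of
    the empirical measure in [domination]. *)
Lemma selection_prob N p (E : set T) (B : set V) (c : T -> R) (J : {set 'I_N}) :
  (1 <= qrank alpha N)%N -> Fhist X U Xh N p E -> measurable B ->
  (forall w, E w -> weight N p w B <= c w) ->
  (Pr (E `&` \bigcap_(i in [set i | i \in J]) (Xh p i @^-1` B)) <=
   \int[Pr]_(w in E) (\prod_(i in J) c w)%:E)%E.
Proof.
move=> q1 FE mB hc; rewrite -set_indices.
have [_ _ hsel _] := HA q1.
rewrite (hsel p E (fun i => if i \in J then B else setT) FE); last first.
  by move=> i; case: ifP.
have weight_ge0 w C : 0 <= weight N p w C.
  by rewrite mulr_ge0 ?invr_ge0// sumr_ge0// => j _; rewrite indicE ler0n.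
apply: ge0_le_integral_nomeas => w Ew; rewrite lee_fin.
  by apply: prodr_ge0 => i _; exact: weight_ge0.
rewrite [leRHS]big_mkcond/=; apply: ler_prod => i _.
rewrite -/(weight N p w _) weight_ge0/=; case: ifP => _; first exact: hc.
rewrite /weight (eq_bigr (fun=> 1)); last by move=> j _; rewrite indicE in_setT.
rewrite sumr_const mulrC -[1 *+ _]/(_%:R).
(* If no particle is above the quantile, the inverse is [0]. *)
have [->|h0] := eqVneq #|[pred j | above N p w j]| 0%N; first by rewrite mul0r.
by rewrite mulfV// pnatr_eq0.
Qed.

Lemma conc_selection p : (p <= n)%N -> concX p -> concXh p.
Proof.
move=> pn cX B mB e0 e0_gt0.
have [e [e_gt0 e_le e_le1]] : exists e, [/\ 0 < e, e <= e0 & e <= 1].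
  by exists (Num.min e0 1); rewrite lt_min e0_gt0 ltr01 !ge_min !lexx orbT.
have /andP[m0 m1] : 0 <= wI p.+1 \1_B <= 1.
  exact: (wI_indic01 HL).
set m := wI p.+1 \1_B in m0 m1 *.
have ae0 : 0 < alpha * e by rewrite mulr_gt0.
(* Expanding (m + e/2)(alpha - 2g), the gain alpha e / 2 = 5g must pay 2g for the numerator, 2gm <=
   2g and ge <= g. The last bound is why [e] was capped at 1. *)
have [g ge] : exists g, 10 * g = alpha * e by exists (alpha * e / 10); field.
have g0 : 0 < g by lra.
have ea : alpha * e <= alpha by rewrite ler_piMr// ltW.
have ga : 2 * g < alpha by lra.
have [G [FG sG HG]] := selection_event pn cX mB g0 ga.
apply: (@small_sub _ _ _ _ _ (fun N => [set w | m + e <= emp N (Xh p ^~ w) \1_B])).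
  by apply: nearW => N w /=; apply: le_trans; rewrite lerD2l.
have hc : (alpha * m + 2 * g) / (alpha - 2 * g) <= m + e / 2.
  rewrite ler_pdivrMr ?subr_gt0//.
  have : g * m <= g by rewrite ler_piMr// ltW.
  have : g * e <= g by rewrite ler_piMr// ltW.
  have -> : (m + e / 2) * (alpha - 2 * g) =
    alpha * m + alpha * e / 2 - 2 * (g * m) - g * e by field.
  by rewrite -ge; lra.
apply: (@conc_step _ _ _ _ _ (fun N => @Xh N p) G (fun _ _ _ => m + e / 2) _ (m + e / 2)) => //.
  by apply/andP; split; lra.
near=> N.
have q1 : (1 <= qrank alpha N)%N by near: N; exact: qrank_gt0_near.
have hN : forall w, G N w ->
      weight N p w B <= (alpha * wI p.+1 \1_B + 2 * g) / (alpha - 2 * g) /\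
      N%:R * (alpha - 2 * g) <= #|[pred j | above N p w j]|%:R by near: N.
split=> //.
- split; first exact: ams_hist_measurable (FG N).
  by move=> i; exact: Xh_measurable.
- by move=> _ _; rewrite addr_ge0// divr_ge0// ltW.
- move=> J; apply: (selection_prob (c := fun=> m + e / 2)) => // w /hN[h _]; exact: le_trans h hc.
- by move=> w _; rewrite sumr_const card_ord mulr_natl.
Unshelve. all: by end_near. Qed.

(** * The mutation kernel at a fixed level *)

Local Notation kf p x B := (fine (K p x B)).

Lemma kernelE p x (B : set V) : measurable B -> K p x B = (kf p x B)%:E.
Proof.
move=> mB; rewrite fineK// ge0_fin_numE// (@le_lt_trans _ _ 1%E) ?ltry//.
rewrite -(@prob_kernel _ _ _ _ _ (K p) x).
by apply: le_measure; rewrite ?inE.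
Qed.

Lemma kf_ge0 p x (B : set V) : 0 <= kf p x B.
Proof. by rewrite fine_ge0. Qed.

Lemma kf_le p x (B C : set V) : measurable B -> measurable C -> B `<=` C ->
  kf p x B <= kf p x C.
Proof.
by move=> mB mC BC; rewrite -lee_fin -!kernelE//; apply: le_measure; rewrite ?inE.
Qed.

Lemma kfT p x : kf p x setT = 1.
Proof. by rewrite prob_kernel. Qed.

Lemma kf_le1 p x (B : set V) : measurable B -> kf p x B <= 1.
Proof. by move=> mB; rewrite -(kfT p x); exact: kf_le. Qed.

Lemma kfU p x (B C : set V) : measurable B -> measurable C ->
  kf p x (B `|` C) <= kf p x B + kf p x C.
Proof.
move=> mB mC; rewrite -lee_fin EFinD -!kernelE//; last exact: measurableU.
exact: measureU2.
Qed.

Lemma kf_split p x (B : set V) : measurable B -> kf p x B + kf p x (~` B) = 1.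
Proof.
move=> mB; apply: EFin_inj; rewrite EFinD -!kernelE//; last exact: measurableC.
rewrite -measureU//; [by rewrite setUv; exact: prob_kernel|exact: measurableC|].
by rewrite setICr.
Qed.

Lemma measurable_kf p (B : set V) : measurable B -> measurable_fun setT (fun x => kf p x B).
Proof.
move=> mB; apply: measurableT_comp => //; exact: measurable_kernel.
Qed.

(* The real-valued version of the mutation kernel [M_{p,L}(x, B)]. *)
Definition mutf p (L : R) (B : set V) (x : V) : R :=
  if L <= S x then kf p x (B `&` [set y | L <= S y]) +
                   kf p x (~` [set y | L <= S y]) * \1_B x
  else \1_B x.

Lemma MkerE p L x (B : set V) : measurable B ->
  Mker (fun x B => K p x B) S L x B = (mutf p L B x)%:E.
Proof.
move=> mB; rewrite /Mker /mutf; case: ifP => // _.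
have mL := measurable_Sge mS L.
rewrite -[[set y | ~ (L <= S y)]]/(~` [set y | L <= S y]).
rewrite EFinD EFinM -!kernelE//; first exact: measurableC.
exact: measurableI.
Qed.

Lemma mutf01 p L B x : measurable B -> 0 <= mutf p L B x <= 1.
Proof.
move=> mB; have mL := measurable_Sge mS L.
rewrite /mutf; case: ifP => _; last by rewrite indicE ler0n lern1 leq_b1.
apply/andP; split; first by rewrite addr_ge0 ?mulr_ge0 ?kf_ge0// indicE ler0n.
rewrite -(kf_split p x mL); apply: lerD.
  by apply: kf_le; [exact: measurableI|exact: mL|move=> y []].
by rewrite ler_piMr ?kf_ge0// indicE lern1 leq_b1.
Qed.

Lemma measurable_mutf p L B : measurable B -> measurable_fun setT (mutf p L B).
Proof.
move=> mB; have mL := measurable_Sge mS L.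
apply: measurable_fun_ifT => //.
- exact: measurable_fun_ler.
- apply: measurable_funD; first by apply: measurable_kf; exact: measurableI.
  apply: measurable_funM; last exact: measurable_indic.
  by apply: measurable_kf; exact: measurableC.
Qed.

(** Off the shell, [x] lies on the same side of both levels, and the two acceptance sets differ only
    inside the shell: this costs one K(x, W) in the accepted part and one in the rejected part. On
    the shell the trivial bound by 1 is enough. *)
Lemma mutf_level p q L B x e : measurable B -> `|L - l q| <= e ->
  mutf p L B x <= mutf p (l q) B x + 2 * kf p x (W q e) + 2 * \1_(W q e) x.
Proof.
move=> mB hL; have mW := measurable_Snear mS (l q) e.
have mL := measurable_Sge mS L; have ml := measurable_Sge mS (l q).
have /andP[h1 h2] := mutf01 p L x mB; have /andP[h3 h4] := mutf01 p (l q) x mB.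
have k0 := kf_ge0 p x (W q e).
have [Wx|nWx] := pselect (W q e x).
  by rewrite [in X in _ + 2 * X]indicE mem_set//=; lra.
rewrite (_ : \1_(W q e) x = 0) ?mulr0 ?addr0; last by rewrite indicE memNset.
have i0 : 0 <= \1_B x :> R by rewrite indicE ler0n.
have i1 : \1_B x <= 1 :> R by rewrite indicE lern1 leq_b1.
move: hL nWx => /= /[!ler_norml] /andP[hL1 hL2] /negP.
rewrite negb_and -!ltNge => nWx.
have side : (L <= S x) = (l q <= S x).
  by apply/idP/idP; case/orP: nWx; lra.
rewrite /mutf side; case: ifP => _; last by lra.
have hA : kf p x (B `&` [set y | L <= S y]) <=
    kf p x (B `&` [set y | l q <= S y]) + kf p x (W q e).
  apply: le_trans (kfU _ _ _ _) => //; last exact: measurableI.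
  apply: kf_le; [exact: measurableI| |].
    by apply: measurableU => //; exact: measurableI.
  move=> y [By /= Ly]; have [h|h] := leP (l q) (S y); first by left.
  by right => /=; rewrite ler_norml; apply/andP; split; lra.
have hC : kf p x (~` [set y | L <= S y]) <=
    kf p x (~` [set y | l q <= S y]) + kf p x (W q e).
  apply: le_trans (kfU _ _ _ _) => //; last exact: measurableC.
  apply: kf_le; [exact: measurableC| |].
    by apply: measurableU => //; exact: measurableC.
  move=> y /= /negP; rewrite -ltNge => Ly.
  have [h|h] := leP (l q) (S y); last by left; apply/negP.
  by right => /=; rewrite ler_norml; apply/andP; split; lra.
have : kf p x (~` [set y | L <= S y]) * \1_B x <=
    (kf p x (~` [set y | l q <= S y]) + kf p x (W q e)) * \1_B x.
  by rewrite ler_wpM2r.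
have : kf p x (W q e) * \1_B x <= kf p x (W q e) by rewrite ler_piMr.
rewrite mulrDl; lra.
Qed.

Hypothesis Hrev : forall p, (0 < p)%N -> forall A B : set V, measurable A -> measurable B ->
  (\int[eta]_(x in A) K p x B = \int[eta]_(x in B) K p x A)%E.

Lemma kernel_invariant p (B : set V) : (0 < p)%N -> measurable B ->
  (\int[eta]_x K p x B = eta B)%E.
Proof.
move=> p0 mB; rewrite Hrev//.
rewrite (eq_integral (cst 1%E)); last by move=> x _; rewrite prob_kernel.
by rewrite integral_cst// mul1e.
Qed.

(** Reversibility makes [eta] invariant under the unrestricted kernel. Integrating over the whole
    space instead of [lset q] is an upper bound, and the normalisation [alpha ^- q] is all that
    remains. *)
Lemma wI_kf p q (B : set V) : (0 < p)%N -> measurable B ->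
  wI q (fun x => kf p x B) <= alpha ^- q * pr B.
Proof.
move=> p0 mB; apply: ler_wpM2l; first by rewrite invr_ge0 exprn_ge0// ltW.
have mA := measurable_lset HL q.
under eq_integral do rewrite -kernelE//.
have h : (\int[eta]_(x in lset q) K p x B <= eta B)%E.
  rewrite -(kernel_invariant p0 mB); apply: ge0_subset_integral => //.
  exact: measurable_kernel.
rewrite /pr fine_le// ?fin_num_measure// ge0_fin_numE ?integral_ge0//.
by apply: le_lt_trans h _; rewrite ltey_eq fin_num_measure.
Qed.

(* Reversibility exchanges [A] and [B `&` A] in the first term of the kernel, which
   then adds up with the second one to [\int_(B `&` A) K p x setT]. *)
Lemma wI_mutf p q (B : set V) : (0 < p)%N -> measurable B ->
  wI q.+1 (mutf p (l q) B) = wI q.+1 \1_B.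
Proof.
move=> p0 mB; rewrite /wint; congr (_ * fine _).
set A := lset q.+1; have mA : measurable A := measurable_lset HL q.+1.
have mAC := measurableC mA.
have mBA : measurable (B `&` A) by exact: measurableI.
rewrite integral_indic//.
transitivity (\int[eta]_(x in A) (K p x (B `&` A) + K p x (~` A) * (\1_B x)%:E))%E.
  apply: eq_integral => x; rewrite inE => Ax.
  have Ax' : l q <= S x := Ax.
  by rewrite /mutf Ax' EFinD EFinM -(kernelE _ _ mBA) -(kernelE _ _ mAC).
have mk C : measurable C -> measurable_fun A (fun x => K p x C).
  by move=> mC; apply: (measurable_funS measurableT) => //; exact: measurable_kernel.
have mi : measurable_fun A (fun x => (\1_B x : R)%:E).
  by apply/measurable_EFinP; exact: measurable_indic.
rewrite ge0_integralD//; last 2 first.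
- exact: mk.
- by apply: emeasurable_funM => //; exact: mk.
rewrite Hrev//.
transitivity (\int[eta]_(x in B `&` A) K p x A + \int[eta]_(x in B `&` A) K p x (~` A))%E.
  congr (_ + _)%E; rewrite setIC integral_mkcondr; apply: eq_integral => x _.
  by rewrite patchE indicE; case: ifP => _; rewrite ?mule1 ?mule0.
rewrite -ge0_integralD//; last 2 first.
- by apply: (measurable_funS measurableT) => //; exact: measurable_kernel.
- by apply: (measurable_funS measurableT) => //; exact: measurable_kernel.
rewrite (eq_integral (cst 1%E)) ?integral_cst ?mul1e// => x _.
by rewrite (kernelE _ _ mA) (kernelE _ _ mAC) -EFinD kf_split.
Qed.

(** * Mutation and the induction on levels *)

Lemma mutation_prob N p (E : set T) (B : set V) (q : 'I_N -> T -> R) (J : {set 'I_N}) :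
  (1 <= qrank alpha N)%N -> Fhalf X U Xh N p E -> measurable B ->
  (forall i w, E w -> mutf p.+1 (LN N p w) B (Xh p i w) <= q i w) ->
  (Pr (E `&` \bigcap_(i in [set i | i \in J]) (X p.+1 i @^-1` B)) <=
   \int[Pr]_(w in E) (\prod_(i in J) q i w)%:E)%E.
Proof.
move=> q1 FE mB hq; rewrite -set_indices.
have [_ _ _ hmut] := HA q1.
have := hmut p E (fun i => if i \in J then B else setT) (fun=> setT) FE.
under eq_bigcapr do rewrite preimage_setT setIT.
have mB' (i : 'I_N) : measurable (if i \in J then B else setT) by case: ifP.
move=> -> //; apply: ge0_le_integral_nomeas => w Ew; rewrite lee_fin.
  apply: prodr_ge0 => i _; rewrite unit_mass mulr1 MkerE//=.
  by have /andP[] := mutf01 p.+1 (LN N p w) (Xh p i w) (mB' i).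
rewrite [leRHS]big_mkcond/=; apply: ler_prod => i _.
rewrite unit_mass mulr1 MkerE//=.
have /andP[-> h1] := mutf01 p.+1 (LN N p w) (Xh p i w) (mB' i).
by case: ifPn h1 => // _ _; exact: hq.
Qed.

Lemma conc_mutation p : (p <= n)%N -> concX p -> concXh p -> concX p.+1.
Proof.
move=> pn cX cXh B mB e e0.
have /andP[m0 m1] : 0 <= wI p.+1 \1_B <= 1 by exact: (wI_indic01 HL).
have w0 : 0 <= alpha ^- p.+1 by rewrite invr_ge0 exprn_ge0// ltW.
have mA := measurable_lset HL p.+1.
(* The empirical means of [f1], [f2], [f3] exceed their targets by g, 2g, 2g; with weights 1, 2, 2
   this makes 9g, below e/2 = 10g. *)
pose g := e / 20.
have g0 : 0 < g by rewrite divr_gt0.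
(* The extra factor [alpha] is for the normalisation at level p + 1, whereas [level_radius] uses
   that of level p. *)
have [r r0 hr] := level_radius HL pn (mulr_gt0 a0 g0).
have hW : alpha ^- p.+1 * pr (W p r) <= g.
  by rewrite exprS invfM -mulrA ler_pdivrMl.
have mW := measurable_Snear mS (l p) r.
have [G [FG sG HG]] := quantile_event pn cX r0.
pose f1 := mutf p.+1 (l p) B; pose f2 x := kf p.+1 x (W p r).
pose f3 : V -> R := \1_(W p r).
have mf1 : measurable_fun setT f1 by exact: measurable_mutf.
have mf2 : measurable_fun setT f2 by exact: measurable_kf.
have mf3 : measurable_fun setT f3 by exact: measurable_indic.
have f1_01 x : 0 <= f1 x <= 1 by exact: mutf01.
have f2_01 x : 0 <= f2 x <= 1 by rewrite kf_ge0 kf_le1.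
have f3_01 x : 0 <= f3 x <= 1 by rewrite /f3 indicE ler0n lern1 leq_b1.
have I1 : wI p.+1 f1 = wI p.+1 \1_B by exact: wI_mutf.
have I2 : wI p.+1 f2 <= g by apply: le_trans (wI_kf _ _ _) hW.
have I3 : wI p.+1 f3 <= g by apply: le_trans (wI_indic_le HL _ mW) hW.
pose E N := G N `&` ([set w | emp N (Xh p ^~ w) f1 < wI p.+1 f1 + g] `&`
  ([set w | emp N (Xh p ^~ w) f2 < wI p.+1 f2 + g] `&`
   [set w | emp N (Xh p ^~ w) f3 < wI p.+1 f3 + g])).
have FE N : Fhalf X U Xh N p (E N).
  apply: histI; first by apply: hist_mono (FG N); rewrite ?leqnSn.
  by apply: histI; [|apply: histI]; apply: hist_Xh_lt.
have sE : small Pr (fun N => ~` E N).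
  have s1 := conc_unit w0 mA cXh mf1 f1_01 g0.
  have s2 := conc_unit w0 mA cXh mf2 f2_01 g0.
  have s3 := conc_unit w0 mA cXh mf3 f3_01 g0.
  apply: small_sub (small_setU sG (small_setU s1 (small_setU s2 s3))).
  apply: nearW => N w; rewrite !setCI => -[h|[/negP h|[/negP h|/negP h]]];
    [by left|right; left|right; right; left|right; right; right];
    by rewrite /= leNgt.
pose q N (i : 'I_N) (w : T) : R :=
  f1 (Xh p i w) + 2 * f2 (Xh p i w) + 2 * f3 (Xh p i w).
apply: (@conc_step _ _ _ _ _ (fun N => @X N p.+1) E q _ (wI p.+1 \1_B + e / 2)) => //.
  by apply/andP; split; lra.
near=> N.
have q1 : (1 <= qrank alpha N)%N by near: N; exact: qrank_gt0_near.
have N0 := N_gt0 q1.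
have hN : forall w, G N w -> l p - r < LN N p w <= l p + r by near: N.
have mXh i : measurable_fun setT (@Xh N p i) by exact: Xh_measurable.
split.
- split; first exact: ams_hist_measurable (FE N).
  by move=> i; exact: X_measurable.
- move=> i; apply: measurable_funD; first apply: measurable_funD.
  + exact: measurableT_comp (mXh i).
  + by apply: measurable_funM => //; exact: measurableT_comp (mXh i).
  + by apply: measurable_funM => //; exact: measurableT_comp (mXh i).
- move=> i w; rewrite /q; move: (f1_01 (Xh p i w)) (f2_01 (Xh p i w)) (f3_01 (Xh p i w)).
  by move=> /andP[? _] /andP[? _] /andP[? _]; rewrite !addr_ge0// mulr_ge0.
- move=> J; apply: mutation_prob => // i w [Gw _]; apply: mutf_level => //.
  by have /andP[] := hN w Gw; rewrite ler_norml => ? ?; apply/andP; split; lra.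
- move=> w [_ [/= h1 [h2 h3]]].
  have -> : \sum_(i < N) q N i w = N%:R * (emp N (Xh p ^~ w) f1 +
      2 * emp N (Xh p ^~ w) f2 + 2 * emp N (Xh p ^~ w) f3).
    rewrite -!empZ -!empD /emp mulrA mulfV ?mul1r//.
    by rewrite pnatr_eq0 -lt0n.
  rewrite ler_pM2l ?ltr0n//; rewrite I1 in h1; rewrite /g in g0 h1 h2 h3 I2 I3.
  lra.
Unshelve. all: by end_near. Qed.

Lemma conc_all p : (p <= n.+1)%N -> concX p.
Proof.
elim: p => [_|p IH pn]; first exact: conc_init.
have cX := IH (leqW pn).
by apply: conc_mutation => //; exact: conc_selection.
Qed.

Lemma bigcap_single N (Y : 'I_N -> T -> V) (B : set V) (i : 'I_N) :
  \bigcap_(j in [set j | j \in [set i]%SET]) (Y j @^-1` B) = Y i @^-1` B.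
Proof.
apply/seteqP; split => w h; first by apply: h; rewrite /= inE.
by move=> j /=; rewrite inE => /eqP ->.
Qed.

(** * Convergence in probability for square-integrable functions *)

Definition dominated_on (N : nat) (E : set T) (Y : 'I_N -> T -> V) (C : R) : Prop :=
  forall i B, measurable B -> (Pr (E `&` (Y i @^-1` B)) <= C%:E * eta B)%E.

(** The domination of sets is an inequality between [C] times [eta] and the image by [Y i] of the
    restriction of [Pr] to [E]; it passes to integrals of nonnegative functions. *)
Lemma dominated_integral N (E : set T) (Y : 'I_N -> T -> V) (C : R) (i : 'I_N)
    (h : V -> \bar R) : measurable E -> measurable_fun setT (Y i) -> 0 <= C ->
  dominated_on E Y C -> measurable_fun setT h -> (forall x, 0 <= h x)%E ->
  (\int[Pr]_(w in E) h (Y i w) <= C%:E * \int[eta]_x h x)%E.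
Proof.
move=> mE mY C0 HD mh h0.
pose Ymix := isMeasurableFun.Build _ _ _ _ _ mY.
pose Yp : {mfun T >-> V} := HB.pack (Y i) Ymix.
pose PrE : {measure set T -> \bar R} := mrestr Pr mE.
have -> : (\int[Pr]_(w in E) h (Y i w) = \int[PrE]_(w in E) h (Y i w))%E.
  by apply: eq_measure_integral => A mA AE; rewrite /PrE/= /mrestr setIidl.
have mhY : measurable_fun setT (fun w => h (Y i w)) by exact: measurableT_comp.
apply: (@le_trans _ _ (\int[PrE]_w h (Y i w))%E).
  by apply: ge0_subset_integral.
have -> : (\int[PrE]_w h (Y i w) = \int[pushforward PrE Yp]_y h y)%E.
  by rewrite ge0_integral_pushforward.
rewrite -[C]/((NngNum C0)%:num) -ge0_integral_mscale//.
apply: ge0_le_measure_integral => // B mB.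
by rewrite /= /pushforward /mrestr /mscale/= setIC; exact: HD.
Qed.

(** One level multiplies [C] by 4 / alpha. Having at least N alpha / 2 survivors costs 2 / alpha at
    selection; mutation costs 2, because its kernel is at most delta_x + K(x, .) at every level and
    K preserves [eta]. *)
Lemma domination p : (p <= n.+1)%N -> exists (C : R) (G : nat -> set T),
  [/\ 0 <= C, forall N, Fhist X U Xh N p (G N), small Pr (fun N => ~` G N) &
     \forall N \near \oo, dominated_on (G N) (@X N p) C].
Proof.
elim: p => [_|p IH pn].
  exists 1, (fun=> setT); split=> //.
  - by move=> N; exact: histT.
  - by under [X in small _ X]eq_fun do rewrite setCT; exact: small_set0.
  apply: filterS qrank_gt0_near => N q1 i B mB; rewrite setTI mul1e.
  have := init_prob [set i]%SET q1 mB.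
  by rewrite bigcap_single big_set1 -prE.
have [C [G [C0 FG sG HG]]] := IH (leqW pn).
have cX := conc_all (leqW pn).
have a4 : 0 < alpha / 4 by rewrite divr_gt0.
have a42 : 2 * (alpha / 4) < alpha by move: a0; lra.
have [H [FH sH HH]] := selection_event pn cX measurableT a4 a42.
pose a := alpha - 2 * (alpha / 4).
have aa0 : 0 < a by rewrite subr_gt0.
pose E N := G N `&` H N.
have FE N : Fhist X U Xh N p (E N) by apply: histI; [exact: FG|exact: FH].
exists (2 * (C / a)), E; split.
- by rewrite mulr_ge0// divr_ge0// ltW.
- by move=> N; apply: hist_mono (FE N); rewrite ?leqnSn.
- apply: small_sub (small_setU sG sH).
  by apply: nearW => N w; rewrite setCI.
near=> N => i B mB.
have q1 : (1 <= qrank alpha N)%N by near: N; exact: qrank_gt0_near.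
have N0 := N_gt0 q1; have NR0 : 0 < N%:R :> R by rewrite ltr0n.
have dG : dominated_on (G N) (@X N p) C by near: N.
have hH : forall w, H N w -> weight N p w setT <=
      (alpha * wI p.+1 \1_setT + 2 * (alpha / 4)) / (alpha - 2 * (alpha / 4)) /\
      N%:R * a <= #|[pred j | above N p w j]|%:R by near: N.
have mE : measurable (E N) by exact: ams_hist_measurable (FE N).
have mG : measurable (G N) by exact: ams_hist_measurable (FG N).
have mYB (Y : 'I_N -> T -> V) j D : (forall k, measurable_fun setT (Y k)) ->
    measurable D -> measurable (Y j @^-1` D).
  by move=> mY mD; rewrite -[_ @^-1` _]setTI; exact: mY.
have mX j : measurable_fun setT (@X N p j) by exact: X_measurable.
have mXh j : measurable_fun setT (@Xh N p j) by exact: Xh_measurable.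
have dXh : dominated_on (E N) (@Xh N p) (C / a).
  move=> j D mD.
  (* Dividing by the guaranteed number of survivors and summing over all particles eliminates
     [above], leaving an integrand that is measurable and controlled by the induction hypothesis. *)
  pose c w : R := (N%:R * a)^-1 * \sum_(k < N) \1_D (X p k w).
  have hc w : E N w -> weight N p w D <= c w.
    move=> [_ /hH[_ hw]]; apply: ler_pM.
    - by rewrite invr_ge0.
    - by rewrite sumr_ge0// => k _; rewrite indicE ler0n.
    - by rewrite lef_pV2 ?posrE ?mulr_gt0// (lt_le_trans _ hw)// mulr_gt0.
    - rewrite big_mkcond/=; apply: ler_sum => k _; rewrite indicE.
      by case: ifP => _ //; rewrite ler0n.
  have := selection_prob [set j]%SET q1 (FE N) mD hc.
  rewrite bigcap_single; under eq_integral do rewrite big_set1.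
  move=> /le_trans; apply.
  have mi (k : 'I_N) : measurable_fun (E N) (fun w => (\1_D (X p k w) : R)%:E).
    apply/measurable_EFinP; apply: (measurable_funS measurableT) => //.
    apply: (measurableT_comp _ (mX k)); exact: measurable_indic.
  under eq_integral do rewrite /c EFinM -sumEFin.
  rewrite ge0_integralZl_EFin//; last 3 first.
  - by move=> w _; rewrite sume_ge0// => k _; rewrite lee_fin indicE ler0n.
  - exact: emeasurable_sum.
  - by rewrite invr_ge0 mulr_ge0// ltW.
  rewrite ge0_integral_sum//.
  apply: (@le_trans _ _ ((N%:R * a)^-1%:E * \sum_(k < N) C%:E * eta D)%E).
    apply: lee_wpmul2l; first by rewrite lee_fin invr_ge0 mulr_ge0// ltW.
    apply: lee_sum => k _; apply: le_trans (dG k D mD).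
    rewrite (_ : (fun w => _) = (fun w => (\1_(X p k @^-1` D) w : R)%:E)); last first.
      by apply/funext => w; rewrite !indicE.
    rewrite integral_indic//; last exact: mYB.
    apply: le_measure; rewrite ?inE.
    + by apply: measurableI => //; exact: mYB.
    + by apply: measurableI => //; exact: mYB.
    + by rewrite setIC; apply: setSI => w [].
  rewrite (prE eta mD) -EFinM sumEFin -EFinM lee_fin.
  rewrite sumr_const card_ord -[(C * pr D) *+ N]mulr_natl.
  have -> : (N%:R * a)^-1 * (N%:R * (C * pr D)) = C / a * pr D.
    by field; rewrite !gt_eqF.
  exact: lexx.
pose q (j : 'I_N) w : R := \1_B (Xh p j w) + kf p.+1 (Xh p j w) B.
have hq j w : E N w -> mutf p.+1 (LN N p w) B (Xh p j w) <= q j w.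
  move=> _; have mL := measurable_Sge mS (LN N p w).
  have i0 : 0 <= \1_B (Xh p j w) :> R by rewrite indicE ler0n.
  rewrite /mutf /q; case: ifP => _; last by rewrite lerDl kf_ge0.
  rewrite addrC lerD//; first by rewrite ler_piMl ?kf_le1//; exact: measurableC.
  by apply: kf_le => //; exact: measurableI.
have := mutation_prob [set i]%SET q1 (hist_mono (leqnn p) (leqnSn p) (FE N)) mB hq.
rewrite bigcap_single; under eq_integral do rewrite big_set1.
move=> /le_trans; apply.
have mh1 : measurable_fun setT (fun x : V => (\1_B x : R)%:E).
  by apply/measurable_EFinP; exact: measurable_indic.
have mh2 : measurable_fun setT (fun x : V => K p.+1 x B) by exact: measurable_kernel.
have C'0 : 0 <= C / a by rewrite divr_ge0// ltW.
under eq_integral do rewrite /q EFinD -kernelE//.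
rewrite ge0_integralD//; last 2 first.
- by apply: (measurable_funS measurableT) => //; exact: measurableT_comp mh1 (mXh i).
- by apply: (measurable_funS measurableT) => //; exact: measurableT_comp mh2 (mXh i).
have d1 := dominated_integral mE (mXh i) C'0 dXh mh1.
have d2 := dominated_integral mE (mXh i) C'0 dXh mh2.
rewrite EFinM -muleA mule_natl mule2n; apply: leeD.
  apply: le_trans (d1 _) _; first by move=> x; rewrite lee_fin indicE ler0n.
  by rewrite integral_indic// setIT.
apply: le_trans (d2 _) _; first by [].
by rewrite kernel_invariant.
Unshelve. all: by end_near. Qed.

Lemma LN_ae p : (p <= n)%N ->
  {ae Pr, forall w, (fun N => LN N p w) @ \oo --> l p}.
Proof.
move=> pn; apply: small_ae_cvg => e e0.
have e2 : 0 < e / 2 by rewrite divr_gt0.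
have [G [_ sG HG]] := quantile_event pn (conc_all (leqW pn)) e2.
apply: small_sub sG; apply: filterS HG => N h w /= he Gw.
by have := h w Gw; move: he; rewrite ler_normr => /orP[] ? /andP[]; lra.
Qed.

Let w_ge0 p : 0 <= alpha ^- p.
Proof. by rewrite invr_ge0 exprn_ge0// ltW. Qed.

Lemma emp_ae p (f : V -> R) (M : R) : (p <= n)%N -> measurable_fun setT f ->
  (forall x, `|f x| <= M) ->
  {ae Pr, forall w, (fun N => emp N (X p ^~ w) f) @ \oo --> wI p f}.
Proof.
move=> pn mf fM; apply: small_ae_cvg => e e0.
exact: (conc_bounded (w_ge0 p) (measurable_lset HL p) (conc_all (leqW pn))
  (wint_mass HL (leqW pn)) mf fM e0).
Qed.

Lemma emp_prob p (f : V -> R) (e : R) : (p <= n)%N -> measurable_fun setT f ->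
  eta.-integrable setT (fun x => (f x ^+ 2)%:E) -> 0 < e ->
  (fun N => Pr [set w | e < `|emp N (X p ^~ w) f - wI p f|]) @ \oo --> 0%E.
Proof.
move=> pn mf If2 e0.
have mA := measurable_lset HL p.
have mD g N c : (1 <= qrank alpha N)%N -> measurable_fun setT g ->
    measurable_fun setT (fun w => `|emp N (X p ^~ w) g - c|).
  move=> q1 mg; apply: measurableT_comp => //; apply: measurable_funB => //.
  by apply: measurable_emp => // i; exact: X_measurable.
suff key dlt : 0 < dlt -> \forall N \near \oo,
    (Pr [set w | e < `|emp N (X p ^~ w) f - wI p f|]%R <= dlt%:E)%E.
  apply/fine_cvgP; split.
    apply: filterS (key 1 ltr01) => N h.
    by rewrite ge0_fin_numE// (le_lt_trans h)// ltry.
  apply/cvgrPdist_le => dlt d0; apply: filterS (key dlt d0) => N h.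
  rewrite sub0r normrN ger0_norm ?fine_ge0// -lee_fin fineK//.
  by rewrite ge0_fin_numE// (le_lt_trans h)// ltry.
move=> d0.
have [C [G [C0 FG sG HG]]] := domination (leqW pn).
pose f2 x := f x ^+ 2.
have mf2 : measurable_fun setT f2 by exact: measurable_funX.
have f20 x : 0 <= f2 x by exact: sqr_ge0.
have If2A : eta.-integrable (lset p) (EFin \o f2) by exact: integrableS If2.
pose Q := fine (\int[eta]_x (f2 x)%:E)%E.
have QE : (\int[eta]_x (f2 x)%:E = Q%:E)%E by rewrite fineK//; exact: integrable_fin_num.
have Q0 : 0 <= Q by rewrite fine_ge0// integral_ge0// => x _; rewrite lee_fin.
have e3 : 0 < e / 3 by rewrite divr_gt0.
have d3 : 0 < dlt / 3 by rewrite divr_gt0.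
have W0 : 0 <= wI p f2 by apply: wint_ge0.
(* The first term makes the truncation error of the limit at most e/3, the second makes the Markov
   bound at most dlt/3, and the 1 ensures positivity. *)
pose M := 3 * wI p f2 / e + C * Q / (e / 3 * (dlt / 3)) + 1.
have ed0 : 0 < e / 3 * (dlt / 3) by rewrite mulr_gt0.
have M1 : 0 <= 3 * wI p f2 / e by apply: divr_ge0; [exact: mulr_ge0|exact: ltW].
have M2 : 0 <= C * Q / (e / 3 * (dlt / 3)) by apply: divr_ge0; [exact: mulr_ge0|exact: ltW].
have M0 : 0 < M by rewrite /M; lra.
pose fM x := if `|f x| <= M then f x else 0.
have mfM : measurable_fun setT fM.
  apply: measurable_fun_ifT => //.
  by apply: measurable_fun_ler => //; exact: measurableT_comp.
have fMM x : `|fM x| <= M by rewrite /fM; case: ifP => // _; rewrite normr0 ltW.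
(* Where |f| > M, one has |f| <= f^2 / M; second moments thus control the truncation error both in
   the limit and empirically. *)
have fdiff x : `|f x - fM x| <= M^-1 * f2 x.
  rewrite /fM /f2; case: ifPn => h; first by rewrite subrr normr0 mulr_ge0 ?sqr_ge0 ?invr_ge0 ?ltW.
  rewrite subr0 ler_pdivlMl// -real_normK ?num_real// expr2 ler_wpM2r//.
  by rewrite ltW// ltNge.
have IfM : eta.-integrable (lset p) (EFin \o fM) by exact: bounded_integrable fMM.
have Icst : eta.-integrable (lset p) (EFin \o (fun=> 1)).
  by apply: (@bounded_integrable _ _ _ _ mA _ 1) => // x; rewrite normr1.
have If : eta.-integrable (lset p) (EFin \o f).
  apply: (le_integrable mA _ _ (integrableD_real mA Icst If2A)).
    by apply/measurable_EFinP; exact: measurable_funS mf.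
  move=> x _ /=; rewrite lee_fin [leRHS]ger0_norm ?addr_ge0//.
  rewrite /f2 -real_normK ?num_real//.
  have := sqr_ge0 (`|f x| - 1); have := normr_ge0 (f x); nra.
have IMf2 : eta.-integrable (lset p) (EFin \o (fun x => M^-1 * f2 x)).
  by have := integrableZl mA M^-1 If2A; apply: eq_integrable => // x _ /=; rewrite EFinM.
have fMdiff g h x : `|g x - h x| <= M^-1 * f2 x -> g x <= h x + M^-1 * f2 x.
  by move=> /(le_trans (ler_norm _)); rewrite lerBlDl.
have wM : M^-1 * wI p f2 <= e / 3.
  rewrite ler_pdivrMl// mulrC -ler_pdivrMl// invf_div mulrC mulrA [_ * 3]mulrC.
  by rewrite /M; lra.
have wdiff : `|wI p fM - wI p f| <= e / 3.
  apply: le_trans wM; rewrite -wintZ// ler_norml; apply/andP; split.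
    rewrite lerBrDl lerBlDr -wintD//; apply: wint_le => //.
      exact: integrableD_real.
    by move=> x _; apply: (fMdiff f fM).
  rewrite lerBlDl -wintD//; apply: wint_le => //.
    exact: integrableD_real.
  by move=> x _; apply: (fMdiff fM f); rewrite distrC.
have ediff N w : `|emp N (X p ^~ w) f - emp N (X p ^~ w) fM| <=
    M^-1 * emp N (X p ^~ w) f2.
  rewrite -empZ ler_norml; apply/andP; split.
    rewrite lerBrDl lerBlDr -empD; apply: emp_le => x.
    by apply: (fMdiff fM f); rewrite distrC.
  by rewrite lerBlDl -empD; apply: emp_le => x; apply: (fMdiff f fM).
pose D1 N := [set w | e / 3 <= `|emp N (X p ^~ w) fM - wI p fM|].
pose D3 N := [set w | e / 3 * M <= emp N (X p ^~ w) f2].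
have sD1 : small Pr D1 := conc_bounded (w_ge0 p) mA (conc_all (leqW pn))
  (wint_mass HL (leqW pn)) mfM fMM e3.
have mD1 : \forall N \near \oo, measurable (D1 N).
  by apply: filterS qrank_gt0_near => N q1; apply: measurable_le_set => //; exact: mD.
have mCG : \forall N \near \oo, measurable (~` G N).
  apply: filterS qrank_gt0_near => N q1; apply: measurableC.
  exact: ams_hist_measurable (FG N).
near=> N.
have q1 : (1 <= qrank alpha N)%N by near: N; exact: qrank_gt0_near.
have N0 := N_gt0 q1; have NR0 : 0 < N%:R :> R by rewrite ltr0n.
have dG : dominated_on (G N) (@X N p) C by near: N.
have mG : measurable (G N) by exact: ams_hist_measurable (FG N).
have mX i : measurable_fun setT (@X N p i) by exact: X_measurable.
have mD1N : measurable (D1 N) by near: N.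
have memp : measurable_fun setT (fun w => emp N (X p ^~ w) f2) by exact: measurable_emp.
have mD3 : measurable (D3 N) by exact: measurable_le_set.
have mGD : measurable (G N `&` D3 N) by exact: measurableI.
have P1 : (Pr (D1 N) <= (dlt / 3)%:E)%E by near: N; exact: small_prob_le.
have P2 : (Pr (~` G N) <= (dlt / 3)%:E)%E by near: N; exact: small_prob_le.
have memp0 w : 0 <= emp N (X p ^~ w) f2 by exact: emp_ge0.
have mi (i : 'I_N) : measurable_fun (G N) (fun w => (f2 (X p i w))%:E).
  apply/measurable_EFinP; apply: (measurable_funS measurableT) => //.
  exact: measurableT_comp mf2 (mX i).
(* Restricting to [G N] makes the domination available: there the empirical second moment has
   integral at most C Q, uniformly in N. *)
have markov : ((e / 3 * M)%:E * Pr (G N `&` D3 N) <= (C * Q)%:E)%E.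
  rewrite -integral_cst//.
  apply: (@le_trans _ _ (\int[Pr]_(w in G N `&` D3 N) (emp N (X p ^~ w) f2)%:E)%E).
    apply: ge0_le_integral_nomeas => w [_ Dw]; rewrite lee_fin//.
    by rewrite mulr_ge0// ltW.
  apply: (@le_trans _ _ (\int[Pr]_(w in G N) (emp N (X p ^~ w) f2)%:E)%E).
    apply: ge0_subset_integral => //.
      by apply/measurable_EFinP; exact: measurable_funS memp.
    by move=> w _; rewrite lee_fin.
  under eq_integral do rewrite /emp EFinM -sumEFin.
  rewrite ge0_integralZl_EFin//; last 2 first.
  - by move=> w _; rewrite sume_ge0// => k _; rewrite lee_fin.
  - exact: emeasurable_sum.
  rewrite ge0_integral_sum//; last by move=> k w _; rewrite lee_fin.
  apply: (@le_trans _ _ ((N%:R)^-1%:E * \sum_(k < N) (C * Q)%:E)%E).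
    apply: lee_wpmul2l; first by rewrite lee_fin invr_ge0.
    apply: lee_sum => k _; rewrite EFinM -QE.
    apply: (dominated_integral mG (mX k) C0 dG (h := EFin \o f2)).
      exact/measurable_EFinP.
    by move=> x; rewrite lee_fin.
  rewrite sumEFin -EFinM lee_fin sumr_const card_ord -[(C * Q) *+ N]mulr_natl.
  by rewrite (mulKf (lt0r_neq0 NR0)).
have P3 : (Pr (G N `&` D3 N) <= (dlt / 3)%:E)%E.
  have eM : 0 < e / 3 * M by rewrite mulr_gt0.
  have Pf : Pr (G N `&` D3 N) \is a fin_num by exact: fin_num_measure.
  move: markov; rewrite -(fineK Pf) -EFinM !lee_fin => h.
  rewrite -(ler_pM2l eM); apply: le_trans h _.
  rewrite mulrAC -ler_pdivrMl// mulrC.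
  by rewrite /M; lra.
apply: (@le_trans _ _ (Pr (D1 N `|` (~` G N `|` (G N `&` D3 N))))).
  apply: le_measure; rewrite ?inE.
  - by apply: measurable_lt_set => //; exact: mD.
  - by apply: measurableU => //; apply: measurableU => //; exact: measurableC.
  move=> w /= he; have [h1|h1] := leP (e / 3) `|emp N (X p ^~ w) fM - wI p fM|.
    by left.
  right; have [Gw|nG] := pselect (G N w); last by left.
  right; split=> //; rewrite /D3/= leNgt; apply/negP => h3.
  have h2 := ediff N w.
  have h4 : M^-1 * emp N (X p ^~ w) f2 < e / 3 by rewrite ltr_pdivrMl// mulrC.
  have := ler_distD (emp N (X p ^~ w) fM) (emp N (X p ^~ w) f) (wI p f).
  have := ler_distD (wI p fM) (emp N (X p ^~ w) fM) (wI p f).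
  lra.
have mGC := measurableC mG.
have U1 : (Pr (D1 N `|` (~` G N `|` (G N `&` D3 N))) <=
    Pr (D1 N) + Pr (~` G N `|` (G N `&` D3 N)))%E.
  by apply: measureU2 => //; exact: measurableU.
have U2 : (Pr (~` G N `|` (G N `&` D3 N)) <=
    Pr (~` G N) + Pr (G N `&` D3 N))%E by exact: measureU2.
apply: le_trans U1 _; apply: le_trans (leeD (lexx _) U2) _.
apply: le_trans (leeD P1 (leeD P2 P3)) _.
by rewrite -!EFinD lee_fin; lra.
Unshelve. all: by end_near. Qed.

End ams.

Theorem theorem1 (R : realType) (d : nat) (hd : (1 <= d)%N)
  (eta : probability 'rV[R]_d R) (S : 'rV[R]_d -> R)
  (alpha Lstar : R) (n : nat)
  (K : nat -> R.-pker 'rV[R]_d ~> 'rV[R]_d)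
  (dO : measure_display) (Omega : measurableType dO) (Pr : probability Omega R)
  (X : forall N : nat, nat -> 'I_N -> Omega -> 'rV[R]_d)
  (U : forall N : nat, nat -> 'I_N -> Omega -> R)
  (Xh : forall N : nat, nat -> 'I_N -> Omega -> 'rV[R]_d) :
  (* eta has a density w.r.t. Lebesgue measure *)
  leb_abs_cont eta ->
  (* S Lipschitz with |DS| > 0 a.e. (S measurable, which follows) *)
  lipschitz S -> measurable_fun setT S -> grad_nonzero_ae S ->
  0 < alpha < 1 ->
  (* P = P(Y >= Lstar) > 0 *)
  0 < fine (eta [set x | Lstar <= S x]) ->
  (* n = floor(log P / log alpha) *)
  n%:R <= ln (fine (eta [set x | Lstar <= S x])) / ln alpha < n%:R + 1 ->
  (* r = P alpha^{-n} in (alpha, 1) *)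
  alpha < fine (eta [set x | Lstar <= S x]) / alpha ^+ n < 1 ->
  (* Y = S(X) has a density f_Y, continuous and positive at each L_p *)
  (exists fY : R -> R,
     (forall y, 0 <= fY y) /\ measurable_fun setT fY /\
     (forall t : R, cdfY eta S t =
        (\int[lebesgue_measure]_(y in `]-oo, t]) (fY y)%:E)%E) /\
     (forall p, (p <= n)%N ->
        {for Lq eta S alpha p, continuous fY} /\ 0 < fY (Lq eta S alpha p))) ->
  (* each K_p (p >= 1) is reversible w.r.t. eta *)
  (forall p, (0 < p)%N -> forall A B : set 'rV[R]_d, measurable A -> measurable B ->
     (\int[eta]_(x in A) K p x B = \int[eta]_(x in B) K p x A)%E) ->
  (* (X, U, Xh) is the N-particle AMS algorithm, for every N *)
  is_AMS S alpha X U Xh Pr eta K ->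
  forall p, (p <= n)%N ->
  [/\ (* L_p^N -> L_p almost surely *)
      {ae Pr, forall w, (fun N => LN S alpha X U N p w) @ \oo --> Lq eta S alpha p},
      (* eta_p^N(f) -> eta_p(f) in probability, for f in L^2(eta) *)
      (forall f : 'rV[R]_d -> R, measurable_fun setT f ->
         eta.-integrable setT (fun x => (f x ^+ 2)%:E) ->
         forall e : R, 0 < e ->
         (fun N => Pr [set w | e < `| emp N (X N p ^~ w) f - eta_p eta S alpha p f |])
           @ \oo --> 0%E) &
      (* eta_p^N(f) -> eta_p(f) almost surely, for bounded measurable f *)
      (forall f : 'rV[R]_d -> R, measurable_fun setT f ->
         (exists M : R, forall x, `|f x| <= M) ->
         {ae Pr, forall w, (fun N => emp N (X N p ^~ w) f) @ \oo --> eta_p eta S alpha p f})].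
Proof.
move=> _ _ mS _ alpha01 _ _ _ [fY [fY0 [mfY [cdfE fYl]]]] Hrev HA p pn.
have HL : regular_levels eta S alpha n fY by split.
split.
- exact: (LN_ae HL HA Hrev pn).
- move=> f mf If2 e e0; exact: (emp_prob HL HA Hrev pn mf If2 e0).
- by move=> f mf [M fM]; exact: (emp_ae HL HA Hrev pn mf fM).
Qed.
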